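(* Let $\eta$ be a primitive $7$-th root of unity. Call a real polynomial $G(x,y,z)$ special if $G(\eta x,\eta^2y,\eta^4z)=G(x,y,z)$, $G=1$ on the plane $x+y+z=1$, $G$ has only non-negative coefficients, and $G(0,0,0)=0$. Then: (1) there is no special $G$ with $0\le N(G)<17$; (2) there is no special $G$ with $17<N(G)<29$; (3) there exist special $G$ with $N(G)=29,30,32,33,34$, and for each integer $k\ge 37$ there is a special $G$ with $N(G)=k$.
   Context: $N(G)$ denotes the number of distinct monomials with nonzero coefficient in $G$. The invariance condition is equivalent to: every monomial $x^ay^bz^c$ of $G$ satisfies $a+2b+4c\equiv0\pmod 7$. *)

(* Defs.v *)
From HB Require Import structures.
From mathcomp Require Import all_boot all_order all_algebra.
From mathcomp Require Import mpoly.
From mathcomp Require Import complex.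
From mathcomp Require Import reals.
Set Implicit Arguments. Unset Strict Implicit. Unset Printing Implicit Defensive.
Import Order.TTheory GRing.Theory Num.Theory.
Local Open Scope ring_scope.

Definition vec3 (T : Type) (d : T) (x y z : T) : 'I_3 -> T :=
  fun i => nth d [:: x; y; z] i.

Definition cevalR (R : rcfType) (G : {mpoly R[3]}) (x y z : R[i]) : R[i] :=
  mmap (fun r : R => (r%:C)%C) (vec3 0 x y z) G.

Definition invariant7 (R : rcfType) (eta : R[i]) (G : {mpoly R[3]}) : Prop :=
  forall x y z : R[i],
    cevalR G (eta * x) (eta ^+ 2 * y) (eta ^+ 4 * z) = cevalR G x y z.

Definition special (R : rcfType) (eta : R[i]) (G : {mpoly R[3]}) : Prop :=
  [/\ invariant7 eta G,
      (forall x y z : R, x + y + z = 1 -> G.@[vec3 0 x y z] = 1),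
      (forall m, 0 <= G@_m) &
      G.@[vec3 0 0 0 0] = 0].

Definition Nmon (R : ringType) (G : {mpoly R[3]}) : nat := size (msupp G).

(* Main.v *)
Require Import Defs.
From HB Require Import structures.
From mathcomp Require Import all_boot all_order all_algebra.
From mathcomp Require Import mpoly.
From mathcomp Require Import complex.
From mathcomp Require Import reals.
From mathcomp Require Import ring lra zify.
Set Implicit Arguments. Unset Strict Implicit. Unset Printing Implicit Defensive.
Import Order.TTheory GRing.Theory Num.Theory.
Local Open Scope ring_scope.

(* Let H be the quotient of 1 - G by 1 - Phi, where Phi is the special polynomial with 17
   monomials: 1 - Phi is the product over j of 1 - eta^j x - eta^(2j) y - eta^(4j) z, and
   invariance makes 1 - G vanish on all seven planes.  The gap says that H = 1 as soon as
   N(G) <= 28.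

   In two variables, a polynomial g with non-negative coefficients, g(0,0) = 0 and g = 1 on
   x + y = 1 has degree less than the number of its monomials counted with weight 2 off the
   axes and 1 on them: the signs of the coefficients of (1 - g)/(1 - x - y) colour the nodes
   of a triangular grid, and where no two terms of opposite sign cancel the coefficient of g
   is non-zero.  Applied to G(u^3, 3uv, v^3) this bounds the exponents of G, hence those of
   H; applied to G(x, y, 0) and its cyclic images it makes a large degree of H on a face
   expensive.  A finite search over the signs of the 46 possible coefficients of H then
   leaves only H = 1: a node where all contributions to G are non-negative and one is
   positive is a monomial of G, and one where they are all non-positive, one being negative,
   is impossible.

   For existence, replace a monomial c m of G by c m Phi, or half of it, and record only
   the support; at a monomial x^d dominating all others this adds exactly 16 monomials. *)

Local Notation C2 := (polyC \o polyC).
Local Notation C3 := (polyC \o (polyC \o polyC)).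

(** * Evaluation of lists of terms *)

Definition expo := (nat * nat * nat)%type.

Definition add_expo (u v : expo) : expo :=
  ((u.1.1 + v.1.1)%N, (u.1.2 + v.1.2)%N, (u.2 + v.2)%N).
Definition sub_expo (u v : expo) : expo :=
  ((u.1.1 - v.1.1)%N, (u.1.2 - v.1.2)%N, (u.2 - v.2)%N).
Definition le_expo (u v : expo) :=
  [&& u.1.1 <= v.1.1, u.1.2 <= v.1.2 & u.2 <= v.2]%N.
Definition deg_expo (v : expo) := (v.1.1 + v.1.2 + v.2)%N.
Definition weight (v : expo) := (v.1.1 + 2 * v.1.2 + 4 * v.2)%N.

(** Polynomials are kept as lists of terms, so that one list can be evaluated in any ring, the
    coefficients entering through [i]. With [C3] and ['X], ['X%:P], ['X%:P%:P] for x, y, z the value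
    is the polynomial itself, x being the outermost variable. *)
Definition ev (R D : pzRingType) (i : R -> D) (X Y Z : D) (L : seq (expo * R)) : D :=
  \sum_(t <- L) i t.2 * (X ^+ t.1.1.1 * Y ^+ t.1.1.2 * Z ^+ t.1.2).

Lemma rmorph_ev (R D E : pzRingType) (i : R -> D) (f : {rmorphism D -> E}) X Y Z L :
  f (ev i X Y Z L) = ev (f \o i) (f X) (f Y) (f Z) L.
Proof. by rewrite rmorph_sum; apply: eq_bigr => t _; rewrite !rmorphM !rmorphXn. Qed.

Lemma eq_ev (R D : pzRingType) (i j : R -> D) X Y Z L :
  i =1 j -> ev i X Y Z L = ev j X Y Z L.
Proof. by move=> e; apply: eq_bigr => t _; rewrite e. Qed.

Lemma poly_roots_inj_eq0 (D : idomainType) (p : {poly D}) (f : nat -> D) :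
  injective f -> (forall n, p.[f n] = 0) -> p = 0.
Proof.
move=> injf r0; apply: (@roots_geq_poly_eq0 _ _ [seq f n | n <- iota 0 (size p)]).
- by apply/allP => x /mapP[n _ ->]; apply/rootP.
- by rewrite map_inj_uniq // iota_uniq.
- by rewrite size_map size_iota.
Qed.

Lemma natr_inj (R : numDomainType) : injective (fun n : nat => n%:R : R).
Proof. by move=> m n /eqP; rewrite eqr_nat => /eqP. Qed.

Lemma poly_fun_eq0 (F : numDomainType) (p : {poly F}) : (forall x, p.[x] = 0) -> p = 0.
Proof. by move=> h; apply: (poly_roots_inj_eq0 (@natr_inj F)). Qed.

Lemma poly2_fun_eq0 (F : numDomainType) (p : {poly {poly F}}) :
  (forall x y, p.[x%:P].[y] = 0) -> p = 0.
Proof.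
move=> h; apply: (@poly_roots_inj_eq0 _ _ (fun n => n%:R%:P)) => [m n /polyC_inj|n].
  exact: natr_inj.
exact: poly_fun_eq0.
Qed.

Lemma poly3_fun_eq0 (F : numDomainType) (p : {poly {poly {poly F}}}) :
  (forall x y z, p.[x%:P%:P].[y%:P].[z] = 0) -> p = 0.
Proof.
move=> h; apply: (@poly_roots_inj_eq0 _ _ (fun n => n%:R%:P%:P)) => [m n|n].
  by move/polyC_inj/polyC_inj; exact: natr_inj.
exact: poly2_fun_eq0.
Qed.

Definition cf (R : nmodType) (L : seq (expo * R)) (v : expo) : R :=
  \sum_(t <- L | t.1 == v) t.2.


Lemma coef_ev3 (R : comNzRingType) (L : seq (expo * R)) a b c :
  (ev C3 'X ('X%:P) ('X%:P%:P) L)`_a`_b`_c = cf L (a, b, c).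
Proof.
rewrite /ev /cf !coef_sum [RHS]big_mkcond; apply: eq_bigr => -[[[a' b'] c'] r] _ /=.
rewrite -!rmorphXn /= -mulrA [_ * ('X^a' * _)]mulrCA -!rmorphM /= mulrC coefMXn coefC subn_eq0.
rewrite !xpair_eqE; have [lt|le] := ltnP a a'; first by rewrite !coef0 gtn_eqF.
have [/eqP e|ne] := leqP a a'; last by rewrite !coef0 ltn_eqF.
have -> : a' == a by rewrite eqn_leq le -subn_eq0 e.
rewrite mulrCA -rmorphM /= mulrC coefMXn.
have [lt|le2] := ltnP b b'; first by rewrite !coef0 gtn_eqF.
rewrite coefC subn_eq0.
have [/eqP e2|ne] := leqP b b'; last by rewrite !coef0 ltn_eqF.
have -> : b' == b by rewrite eqn_leq le2 -subn_eq0 e2.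
by rewrite coefCM coefXn [_ == c]eq_sym /=; case: eqP; rewrite ?mulr1 ?mulr0.
Qed.

(** G(1 - y - z, y, z) - 1 vanishes at all points of an infinite domain, so it is the zero
    polynomial, and the identity specialises to every commutative ring under [F]. *)
Lemma ev_plane (F : numDomainType) (L : seq (expo * F)) :
  (forall x y z, x + y + z = 1 -> ev id x y z L = 1) ->
  forall (D : comNzRingType) (i : {rmorphism F -> D}) (X Y Z : D),
  X + Y + Z = 1 -> ev i X Y Z L = 1.
Proof.
move=> plane D i X Y Z sum1.
have P1 : ev C2 (1 - 'X - 'X%:P) 'X 'X%:P L = 1 :> {poly {poly F}}.
  apply/eqP; rewrite -subr_eq0; apply/eqP/poly2_fun_eq0 => x y; rewrite !hornerD !hornerN !hornerC.
  have -> : (ev C2 (1 - 'X - 'X%:P) 'X 'X%:P L : {poly {poly F}}).[x%:P]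
     = ev polyC (1 - x%:P - 'X) x%:P 'X L.
    rewrite -[LHS]/(horner_eval x%:P _) rmorph_ev !rmorphB rmorph1 /= /horner_eval !hornerE.
    by apply: eq_ev => c /=; rewrite hornerE.
  have -> : (ev polyC (1 - x%:P - 'X) x%:P 'X L : {poly F}).[y] = ev id (1 - x - y) x y L.
    rewrite -[LHS]/(horner_eval y _) rmorph_ev !rmorphB rmorph1 /= /horner_eval !hornerE.
    by apply: eq_ev => c /=; rewrite hornerE.
  by rewrite plane ?subrr //; ring.
pose f1 : {rmorphism {poly F} -> D} := horner_morph (fun q => mulrC (Z) (i q)).
pose f2 : {rmorphism {poly {poly F}} -> D} := horner_morph (fun q => mulrC (Y) (f1 q)).
have := congr1 f2 P1; rewrite rmorph1 rmorph_ev !rmorphB rmorph1 /=.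
have f1C c : f1 c%:P = i c by exact: horner_morphC.
have f1X : f1 'X = Z by exact: horner_morphX.
have f2C q : f2 q%:P = f1 q by exact: horner_morphC.
have f2X : f2 'X = Y by exact: horner_morphX.
rewrite f2C f1X f2X; have -> : 1 - Y - Z = X by rewrite -sum1; ring.
by rewrite (@eq_ev _ _ _ i) // => c /=; rewrite f2C.
Qed.

Lemma horner_ev3 (F : comNzRingType) (L : seq (expo * F)) x y z :
  (ev C3 'X ('X%:P) ('X%:P%:P) L).[x%:P%:P].[y%:P].[z] = ev id x y z L.
Proof.
rewrite -[_.[x%:P%:P]]/(horner_eval x%:P%:P _) rmorph_ev /= /horner_eval !hornerE.
rewrite -[_.[y%:P]]/(horner_eval y%:P _) rmorph_ev /= /horner_eval !hornerE.
rewrite -[_.[z]]/(horner_eval z _) rmorph_ev /= /horner_eval !hornerE.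
by apply: eq_ev => c /=; rewrite !hornerE.
Qed.

(** [L'] lists the terms of G(eta x, eta^2 y, eta^4 z) - G(x, y, z), whose coefficients are those of
    G times eta^w - 1 with w the weight. It vanishes as a function, hence coefficientwise. *)
Lemma invariant_weight (F : numDomainType) (eta : F) (L : seq (expo * F)) :
  7.-primitive_root eta ->
  (forall x y z, ev id (eta * x) (eta ^+ 2 * y) (eta ^+ 4 * z) L = ev id x y z L) ->
  forall v, cf L v != 0 -> (7 %| weight v)%N.
Proof.
move=> heta inv v nz; rewrite (prim_order_dvd heta).
pose L' := [seq (t.1, t.2 * (eta ^+ weight t.1 - 1)) | t <- L].
have : ev C3 'X ('X%:P) ('X%:P%:P) L' = 0.
  apply: poly3_fun_eq0 => x y z; rewrite horner_ev3.
  have /eqP := inv x y z; rewrite -subr_eq0 => /eqP <-.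
  rewrite /ev big_map -sumrB; apply: eq_bigr => t _ /=.
  rewrite (exprMn _ eta x) (exprMn _ (eta ^+ 2) y) (exprMn _ (eta ^+ 4) z).
  rewrite /weight exprD exprD (exprM _ 2) (exprM _ 4).
  by move: ((eta ^+ 2) ^+ _) ((eta ^+ 4) ^+ _) => A B; ring.
move/(congr1 (fun p : {poly {poly {poly F}}} => p`_v.1.1`_v.1.2`_v.2));
  rewrite coef_ev3 !coef0 -!surjective_pairing.
rewrite /cf big_map /= (eq_bigr (fun t => t.2 * (eta ^+ weight v - 1))) => [|t /eqP <- //].
by rewrite -mulr_suml => /eqP; rewrite mulf_eq0 (negPf nz) subr_eq0.
Qed.

(** Natural coefficients serve every ring. The term x^7 comes first because it is split off: it
    makes Phi - 1 monic in x, and it yields the extremal monomials of G. *)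
Definition Phi_terms : seq (expo * nat) :=
  [:: ((7,0,0), 1); ((0,7,0), 1); ((0,0,7), 1);
      ((1,1,1), 14); ((0,3,2), 14); ((2,0,3), 14); ((3,2,0), 14);
      ((0,1,3), 7); ((1,3,0), 7); ((3,0,1), 7);
      ((0,5,1), 7); ((1,0,5), 7); ((5,1,0), 7); ((2,2,2), 7);
      ((1,2,4), 7); ((2,4,1), 7); ((4,1,2), 7)]%N.

Definition PhiL (R : pzRingType) : seq (expo * R) := [seq (t.1, t.2%:R) | t <- Phi_terms].

Lemma ev_Phi_plane (D : comNzRingType) (X Y Z : D) : X + Y + Z = 1 ->
  \sum_(t <- Phi_terms) t.2%:R * (X ^+ t.1.1.1 * Y ^+ t.1.1.2 * Z ^+ t.1.2) = 1.
Proof.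
move=> sum1; have -> : Z = 1 - X - Y by rewrite -sum1; ring.
rewrite /Phi_terms !big_cons big_nil /=; ring.
Qed.

(** * Divisibility of G - 1 by Phi - 1 *)

Lemma ev_twist (D E : comNzRingType) (i : E -> D) (eta X Y Z : D) (L : seq (expo * E)) :
  eta ^+ 7 = 1 -> all (fun t => 7 %| weight t.1)%N L ->
  ev i (eta * X) (eta ^+ 2 * Y) (eta ^+ 4 * Z) L = ev i X Y Z L.
Proof.
move=> eta7 /allP wL; rewrite /ev big_seq [RHS]big_seq; apply: eq_bigr => t /wL /dvdnP[k wk].
congr (_ * _); rewrite (exprMn _ eta X) (exprMn _ (eta ^+ 2) Y) (exprMn _ (eta ^+ 4) Z).
have : eta ^+ t.1.1.1 * (eta ^+ 2) ^+ t.1.1.2 * (eta ^+ 4) ^+ t.1.2 = 1.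
  by rewrite -exprM -exprM -!exprD -[(_ + _)%N]/(weight t.1) wk mulnC exprM eta7 expr1n.
by move: ((eta ^+ 2) ^+ _) ((eta ^+ 4) ^+ _) (eta ^+ t.1.1.1) => A B C e;
  rewrite -[RHS]mul1r -e; ring.
Qed.

Definition Phi3 (R : comNzRingType) : {poly {poly {poly R}}} :=
  ev C3 'X ('X%:P) ('X%:P%:P) (PhiL R).

Lemma size_ev3 (R : comNzRingType) (L : seq (expo * R)) n :
  all (fun t => t.1.1.1 < n)%N L -> (size (ev C3 'X ('X%:P) ('X%:P%:P) L) <= n)%N.
Proof.
move=> /allP hL; apply: (leq_trans (size_sum _ _ _)); rewrite big_seq.
elim/big_ind: _ => // [p q pn qn|t /hL tn]; first by rewrite geq_max pn.
rewrite -!rmorphXn -mulrA mulrCA -!rmorphM /= mulrC.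
rewrite -rmorphM mul_polyC; apply: (leq_trans (size_scale_leq _ _)).
by rewrite size_polyXn.
Qed.

Lemma Phi3_sub1_monic (R : comNzRingType) :
  (Phi3 R - 1 \is monic) /\ size (Phi3 R - 1) = 8%N.
Proof.
pose L := behead (PhiL R); pose r := ev C3 'X ('X%:P) ('X%:P%:P) L - 1.
have -> : Phi3 R - 1 = 'X^7 + r.
  rewrite /r addrA; congr (_ - 1).
  rewrite /Phi3 -[PhiL R]/(((7, 0, 0)%N, 1%:R) :: L) {1}/ev big_cons -/(ev _ _ _ _ _).
  by rewrite /= !expr0 !mulr1 !rmorph1 mul1r.
have sr : (size r < size ('X^7 : {poly {poly {poly R}}}))%N.
  rewrite size_polyXn ltnS; apply: (leq_trans (size_polyD _ _)).
  by rewrite size_polyN size_poly1 geq_max andbT; apply: size_ev3.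
have e : size ('X^7 + r) = 8%N by rewrite size_polyDl // size_polyXn.
split=> //; rewrite monicE lead_coefDl // lead_coefXn //.
Qed.

(** Phi - 1 is monic of degree 7 in x, so G - 1 can be divided by it with a remainder of x-degree
    below 7. Over C[y, z] this remainder has the seven distinct roots [x j], hence is zero. *)
Lemma Phi_divides (R : rcfType) (eta : R[i]) (L : seq (expo * R)) :
  7.-primitive_root eta -> all (fun t => 7 %| weight t.1)%N L ->
  (forall x y z, x + y + z = 1 -> ev id x y z L = 1) ->
  exists q, ev C3 'X ('X%:P) ('X%:P%:P) L = 1 + q * (Phi3 R - 1).
Proof.
move=> heta wL plane; set G := ev _ _ _ _ L.
have [mon sz] := Phi3_sub1_monic R.
pose AC : comNzRingType := {poly {poly R[i]}}.
pose f : {rmorphism {poly {poly R}} -> {poly {poly R[i]}}} := map_poly (map_poly (real_complex R)).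
have finj : injective f.
  by apply: map_inj_poly; rewrite ?rmorph0 //; apply: map_inj_poly; rewrite ?rmorph0 //;
    exact: fmorph_inj.
pose e (n : nat) : {poly {poly R[i]}} := (eta ^+ n)%:P%:P.
have eD m n : e (m + n)%N = e m * e n by rewrite /e exprD !rmorphM.
have e7 n : e (7 * n)%N = 1 by rewrite /e exprM (prim_expr_order heta) expr1n.
(* The solution of eta^j x + eta^(2j) y + eta^(4j) z = 1, with eta^(-j) written as eta^(6j). *)
pose x (j : 'I_7) : {poly {poly R[i]}} := e (6 * j)%N - e j * 'X - e (3 * j)%N * 'X%:P.
have root1 (M : seq (expo * R)) (j : 'I_7) : all (fun t => 7 %| weight t.1)%N M ->
    (forall x y z, x + y + z = 1 -> ev id x y z M = 1) ->
    (map_poly f (ev C3 'X ('X%:P) ('X%:P%:P) M)).[x j] = 1.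
  move=> wM pM.
  rewrite -[LHS]/(horner_morph (fun q => mulrC (x j) (f q)) _) rmorph_ev /=.
  rewrite horner_morphX !horner_morphC /=.
  pose i : {rmorphism R -> AC} := f \o (polyC \o polyC).
  rewrite (@eq_ev _ _ _ i) => [|r]; last by rewrite /= horner_morphC.
  (* Invariance replaces the point (x_j, y, z) by (eta^j x_j, eta^(2j) y, eta^(4j) z), which lies on
     the plane. *)
  rewrite -(@ev_twist _ _ _ (e j)) //; last by rewrite -[RHS](e7 j) /e -!rmorphXn -exprM mulnC.
  apply: ev_plane => //; rewrite /f /= !map_polyX map_polyC /= map_polyX.
  have -> : e j ^+ 2 = e (j + j)%N by rewrite eD expr2.
  have -> : e j ^+ 4 = e (j + 3 * j)%N by rewrite -[RHS]/(e (4 * j)%N) /e -!rmorphXn -exprM mulnC.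
  have : e j * e (6 * j)%N = 1 by rewrite -eD -[RHS](e7 j).
  by rewrite /x !eD => h; rewrite !mulrBr h; ring.
have rootG j : (map_poly f (G - 1)).[x j] = 0.
  by rewrite rmorphB rmorph1 hornerD hornerN hornerC root1 // subrr.
have rootd j : (map_poly f (Phi3 R - 1)).[x j] = 0.
  rewrite rmorphB rmorph1 hornerD hornerN hornerC root1 // ?subrr // => a b c /ev_Phi_plane <-.
  by rewrite /ev /PhiL big_map.
move: (Phi3 R - 1) mon sz rootd => d mon sz rootd.
have [p ep] : exists p, p = G - 1 by exists (G - 1).
have -> : G = 1 + p by rewrite ep addrC subrK.
rewrite -ep in rootG; move: {ep root1 plane wL} p rootG => p rootp.
pose q := Pdiv.Ring.rdivp p d; exists q; congr (_ + _).
have := Pdiv.RingMonic.rdivp_eq mon p; set r := Pdiv.Ring.rmodp _ _ => eq_p.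
have sr : (size r <= 7)%N.
  by rewrite -ltnS -sz; apply: Pdiv.Ring.ltn_rmodpN0; rewrite -size_poly_eq0 sz.
suff r0 : r = 0 by rewrite {1}eq_p r0 addr0.
apply: (map_inj_poly finj (rmorph0 _)); rewrite rmorph0.
apply: (@roots_geq_poly_eq0 _ _ [seq x j | j <- enum 'I_7]).
- apply/allP => _ /mapP[j _ ->]; apply/rootP.
  have -> : r = p - q * d by rewrite {1}eq_p addrC addKr.
  by rewrite rmorphB rmorphM hornerD hornerN hornerM rootp rootd mulr0 subrr.
(* The roots are distinct because their constant terms eta^(6j) are, 6 being prime to 7. *)
- have cx (j : 'I_7) : (x j)`_0`_0 = eta ^+ (6 * j)%N.
    rewrite /x /e !coefB !coefCM !coefC /= !coefX ?coefC /=.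
    by rewrite ?mulr0 ?subr0.
  rewrite map_inj_uniq ?enum_uniq // => i j xij.
  have /eqP := cx i; rewrite xij cx (eq_prim_root_expr heta) => /eqP h.
  apply/val_inj => /=; have := ltn_ord i; have := ltn_ord j; lia.
- rewrite size_map -cardE card_ord (leq_trans _ sr) //; apply: size_poly.
Qed.

(** * The coefficients of G and of the quotient H *)

Definition mon (v : expo) : 'X_{1..3} := [multinom [tuple v.1.1; v.1.2; v.2]].
Definition unmon (m : 'X_{1..3}) : expo := (m ord0, m (inord 1), m (inord 2)).

Lemma monK : cancel mon unmon.
Proof.
case=> [[a b] c]; rewrite /unmon /mon !multinomE !(tnth_nth 0%N) /=.
by rewrite !inordK.
Qed.

Lemma unmonK : cancel unmon mon.
Proof.
move=> m; apply/mnmP => i; rewrite multinomE (tnth_nth 0%N) /unmon.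
case: i => -[|[|[|//]]] lti /=; congr (m _); apply/val_inj => //=; by rewrite inordK.
Qed.

Definition terms (R : nzRingType) (G : {mpoly R[3]}) : seq (expo * R) :=
  [seq (unmon m, G@_m) | m <- msupp G].

Lemma cf_terms (R : nzRingType) (G : {mpoly R[3]}) v : cf (terms G) v = G@_(mon v).
Proof.
rewrite /cf big_map /=; have [vG|vG] := boolP (mon v \in msupp G); last first.
  rewrite (memN_msupp_eq0 vG) big_seq_cond big1 // => m /andP[mG /eqP e].
  by case/negP: vG; rewrite -e unmonK.
rewrite (eq_bigl (fun m => m == mon v)) => [|m]; last by rewrite -(can_eq unmonK) monK.
by rewrite -big_filter filter_pred1_uniq ?msupp_uniq // big_seq1.
Qed.

Lemma mmap1_vec3 (D : nzRingType) (x y z d : D) m :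
  mmap1 (vec3 d x y z) m = x ^+ (unmon m).1.1 * y ^+ (unmon m).1.2 * z ^+ (unmon m).2.
Proof.
rewrite /mmap1 !big_ord_recl big_ord0 mulr1 mulrA /vec3 /=.
congr (_ * _ ^+ m _ * _ ^+ m _); apply/val_inj; by rewrite /= inordK.
Qed.

Lemma mmap_terms (R D : nzRingType) (i : R -> D) (x y z d : D) (G : {mpoly R[3]}) :
  mmap i (vec3 d x y z) G = ev i x y z (terms G).
Proof. rewrite /mmap /ev [RHS]big_map; apply: eq_bigr => m _; by rewrite mmap1_vec3. Qed.

Lemma meval_origin (R : comNzRingType) (G : {mpoly R[3]}) :
  G.@[vec3 0 0 0 0] = G@_(mon (0, 0, 0)%N).
Proof.
rewrite /meval mmap_terms -cf_terms /cf /ev big_map [RHS]big_map [RHS]big_mkcond.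
apply: eq_bigr => m _; move: (unmon m) => [[a b] c] /=; rewrite !expr0n.
by case: a => [|a]; case: b => [|b]; case: c => [|c]; rewrite ?mulr1 ?mulr0 ?mul0r ?mulr0.
Qed.

(** The coefficient at v of H times the monomial s; the test guards the truncated subtraction. *)
Definition shifted (V : nmodType) (h : expo -> V) (v s : expo) : V :=
  if le_expo s v then h (sub_expo v s) else 0.

(** For g and h the coefficients of G and H, [balanced_eq] is G = 1 + (Phi - 1) H read at each
    monomial. With coefficient functions a permutation of the variables is a mere composition. *)
Record balanced (R : numDomainType) (g h : expo -> R) : Prop := Balanced {
  balanced_ge0 : forall v, 0 <= g v;
  balanced_eq : forall v,
    g v = (v == (0, 0, 0)%N)%:R + \sum_(t <- Phi_terms) t.2%:R * shifted h v t.1 - h v;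
  balanced_h0 : h (0, 0, 0)%N = 1;
  balanced_finite : exists K, forall v, h v != 0 -> (deg_expo v < K)%N;
  balanced_weight : forall v, h v != 0 -> (7 %| weight v)%N }.

Lemma coef_mul_mon (R : comNzRingType) (q : {poly {poly {poly R}}}) (c : R) (s : expo) a b d :
  (q * (c%:P%:P%:P * ('X ^+ s.1.1 * 'X%:P ^+ s.1.2 * 'X%:P%:P ^+ s.2)))`_a`_b`_d =
  c * shifted (fun v => q`_v.1.1`_v.1.2`_v.2) (a, b, d) s.
Proof.
rewrite -!rmorphXn.
have -> : q * (c%:P%:P%:P * ('X ^+ s.1.1 * ('X ^+ s.1.2)%:P * ('X ^+ s.2)%:P%:P)) =
   (q * ((c%:P)%:P * ('X ^+ s.1.2) * ('X ^+ s.2)%:P)%:P) * 'X ^+ s.1.1.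
  by rewrite !rmorphM /=; ring.
rewrite coefMXn /shifted /le_expo /=; case: ltnP => la; first by rewrite !coef0 mulr0.
rewrite coefMC.
have -> : q`_(a - s.1.1) * ((c%:P)%:P * ('X ^+ s.1.2) * ('X ^+ s.2)%:P) =
   (q`_(a - s.1.1) * (c%:P * 'X ^+ s.2)%:P) * ('X ^+ s.1.2).
  by rewrite !rmorphM /=; ring.
rewrite coefMXn; case: ltnP => lb; first by rewrite coef0 mulr0.
rewrite coefMC mulrA coefMXn; case: ltnP => ld; first by rewrite mulr0.
by rewrite coefMC mulrC.
Qed.

Lemma special_balanced (R : rcfType) (eta : R[i]) (G : {mpoly R[3]}) :
  7.-primitive_root eta -> special eta G ->
  exists h, balanced (fun v => G@_(mon v)) h.
Proof.
move=> heta [inv plane ge0 at0].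
have wG : all (fun t => 7 %| weight t.1)%N (terms G).
  apply/allP => t /mapP[m mG ->] /=.
  pose L := [seq (t.1, (t.2%:C)%C) | t <- terms G].
  apply: (@invariant_weight _ eta L) => // [x y z|].
    have := inv x y z; rewrite /cevalR !mmap_terms /ev !big_map //.
  rewrite /cf /L big_map /= -(rmorph_sum (real_complex R)) /= -/(cf _ _) cf_terms unmonK.
  by rewrite fmorph_eq0 -mcoeff_msupp.
have pl x y z : x + y + z = 1 -> ev id x y z (terms G) = 1.
  by move/plane; rewrite /meval mmap_terms.
have [q eq_q] := Phi_divides heta wG pl.
exists (fun v => q`_v.1.1`_v.1.2`_v.2).
have g0 : G@_(mon (0, 0, 0)%N) = 0 by rewrite -meval_origin.
have geq v : G@_(mon v) = (v == (0, 0, 0)%N)%:R +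
   \sum_(t <- Phi_terms) t.2%:R * shifted (fun v => q`_v.1.1`_v.1.2`_v.2) v t.1
     - q`_v.1.1`_v.1.2`_v.2.
  case: v => [[a b] c]; rewrite -cf_terms -coef_ev3 eq_q mulrBr mulr1 addrA !coefB !coefD.
  congr (_ + _ - _); first by rewrite !coefC /=; case: a b c => [|a] [|b] [|c];
    rewrite ?coefC ?coef0 ?mulr1n.
  rewrite /Phi3 /ev /PhiL big_map mulr_sumr !coef_sum; apply: eq_bigr => t _ /=.
  exact: coef_mul_mon.
split => //.
(* No monomial of Phi divides 1, so the equation at the origin reads 0 = 1 - h(0). *)
- have := geq (0, 0, 0)%N; rewrite g0 eqxx big1_seq => [|t /andP[_ tP]].
    by rewrite addr0 => /esym/eqP; rewrite subr_eq0 => /eqP <-.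
  have : ~~ le_expo t.1 (0, 0, 0)%N by move: t tP; apply/allP.
  by rewrite /shifted => /negPf ->; rewrite mulr0.
- pose bA := \max_(i < size q) size (q`_i)%R.
  pose bB := \max_(i < size q) \max_(j < size (q`_i)%R) size (q`_i`_j)%R.
  exists (size q + bA + bB)%N => -[[a b] c] /= nz; rewrite /deg_expo /=.
  have la : (a < size q)%N.
    by rewrite ltnNge; apply: contra nz => /(nth_default 0) ->; rewrite !coef0.
  have lb : (b < size (q`_a)%R)%N.
    by rewrite ltnNge; apply: contra nz => /(nth_default 0) ->; rewrite !coef0.
  have lc : (c < size (q`_a`_b)%R)%N.
    by rewrite ltnNge; apply: contra nz => /(nth_default 0) ->.
  have : (size (q`_a)%R <= bA)%N by exact: (leq_bigmax (Ordinal la)).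
  have : (size (q`_a`_b)%R <= bB)%N.
    apply: leq_trans (leq_bigmax (Ordinal la)) => /=; exact: (leq_bigmax (Ordinal lb)).
  by move: la lb lc; move: (size _) bA bB (size _) (size _); lia.
(* Induction on the degree: if 7 does not divide the weight of v, then v is no monomial of G, and
   each v - t has smaller degree and the same weight modulo 7, so h vanishes there. *)
- move=> v; move: {2}(deg_expo v).+1 (ltnSn (deg_expo v)) => n.
  elim: n v => // n IH v dv; apply: contraNT => nw.
  have gv : G@_(mon v) = 0.
    apply/eqP; rewrite mcoeff_eq0; apply: contra nw => vG.
    have /(allP wG) /= : (unmon (mon v), G@_(mon v)) \in terms G by apply: map_f.
    by rewrite monK.
  have v0 : v != (0, 0, 0)%N by apply: contra nw => /eqP ->.
  have := geq v; rewrite gv (negPf v0) add0r big1_seq => [|t /andP[_ tP]].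
    by move/eqP; rewrite sub0r eq_sym oppr_eq0.
  have /andP[wt dt] : (7 %| weight t.1)%N && (0 < deg_expo t.1)%N by move: t tP; apply/allP.
  rewrite /shifted; case: ifP => [/and3P[l1 l2 l3]|_]; last by rewrite mulr0.
  apply/eqP; rewrite mulf_eq0; apply/orP; right; apply: contraNT nw => /IH.
  move: dv dt wt l1 l2 l3; rewrite /deg_expo /weight /sub_expo /=.
  move: (v.1.1) (v.1.2) v.2 t.1.1.1 t.1.1.2 t.1.2 => a b c a' b' c'.
  by move=> dv dt wt l1 l2 l3; lia.
Qed.

(** * Counting terms in two variables *)

Local Close Scope ring_scope.

Definition tri_sum (f : nat -> nat -> nat) n := \sum_(i < n) \sum_(j < n - i) f i j.

(** Each of the three sides can be split off the triangle; this lets a sum of edges over triangles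
    be compared with the same sum over nodes. *)
Lemma tri_sum_row f n :
  tri_sum f n.+1 = \sum_(j < n.+1) f 0 j + tri_sum (fun i j => f i.+1 j) n.
Proof. by rewrite /tri_sum big_ord_recl subn0. Qed.

Lemma tri_sum_col f n :
  tri_sum f n.+1 = \sum_(i < n.+1) f i 0 + tri_sum (fun i j => f i j.+1) n.
Proof.
rewrite /tri_sum (eq_bigr (fun i : 'I_n.+1 => f i 0 + \sum_(j < n - i) f i j.+1)).
  by rewrite big_split /= [X in _ + X]big_ord_recr /= subnn big_ord0 addn0.
by move=> i _; rewrite subSn ?big_ord_recl //; exact: leq_ord.
Qed.

Lemma tri_sum_diag f n :
  tri_sum f n.+1 = tri_sum f n + \sum_(i < n.+1) f i (n - i).
Proof.
rewrite /tri_sum (eq_bigr (fun i : 'I_n.+1 => \sum_(j < n - i) f i j + f i (n - i))).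
  by rewrite big_split /= [X in X + _]big_ord_recr /= subnn big_ord0 addn0.
by move=> i _; rewrite subSn ?big_ord_recr //; exact: leq_ord.
Qed.

Lemma leq_tri_sum f g n : (forall i j, i + j < n -> f i j <= g i j) ->
  tri_sum f n <= tri_sum g n.
Proof.
move=> fg; apply: leq_sum => i _; apply: leq_sum => j _; apply: fg.
by have := ltn_ord j; have := ltn_ord i; lia.
Qed.

Lemma tri_sumD f g n : tri_sum (fun i j => f i j + g i j) n = tri_sum f n + tri_sum g n.
Proof. by rewrite -big_split; apply: eq_bigr => i _; rewrite -big_split. Qed.

Definition differ (x y : bool) : nat := x (+) y.

(* Each edge of the triangular grid lies in one down-pointing triangle, which has
   at most two bichromatic edges, and in one node (the triple (i,j), (i-1,j), (i,j-1)
   with the first colour complemented); there are m+1 more node corners than the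
   triangles can account for. *)
Lemma unmixed_nodes (s : nat -> nat -> bool) (v : nat -> nat -> nat) m :
  (forall i j, i + j < m ->
     ~~ s i.+1 j.+1 = s i j.+1 -> ~~ s i.+1 j.+1 = s i.+1 j -> 0 < v i.+1 j.+1) ->
  (forall i, i <= m -> ~~ s i.+1 0 = s i 0 -> 0 < v i.+1 0) ->
  (forall j, j <= m -> ~~ s 0 j.+1 = s 0 j -> 0 < v 0 j.+1) ->
  (forall i, i <= m -> s i (m - i).+1 = s i.+1 (m - i) -> 0 < v i.+1 (m - i).+1) ->
  m.+1 <= 2 * tri_sum (fun i j => v i.+1 j.+1) m + \sum_(i < m.+1) v i.+1 0
     + \sum_(j < m.+1) v 0 j.+1 + \sum_(i < m.+1) v i.+1 (m - i).+1.
Proof.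
move=> hI hx hy ht.
(* [d1] and [d2] mark the edges between consecutive degrees whose ends have equal colours, [d3] the
   edges within a degree whose ends have different colours. *)
pose d1 i j := differ (~~ s i.+1 j) (s i j).
pose d2 i j := differ (~~ s i j.+1) (s i j).
pose d3 i j := differ (s i j.+1) (s i.+1 j).
have tri : tri_sum (fun i j => d1 i j + d2 i j + d3 i j) m.+1 <= tri_sum (fun _ _ => 2) m.+1.
  apply: leq_tri_sum => i j _; rewrite /d1 /d2 /d3 /differ.
  by case: (s i.+1 j); case: (s i j); case: (s i j.+1).
have inner : tri_sum (fun _ _ => 2) m <= tri_sum (fun i j => v i.+1 j.+1 + v i.+1 j.+1) m
    + tri_sum (fun i j => d1 i j.+1 + d2 i.+1 j + d3 i j) m.
  rewrite -tri_sumD; apply: leq_tri_sum => i j /hI; rewrite /d1 /d2 /d3 /differ.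
  case: (s i.+1 j.+1); case: (s i j.+1); case: (s i.+1 j) => //= h; try lia;
  by have := h erefl erefl; lia.
have side (a b : nat -> nat) : (forall i, i <= m -> b i = 0 -> 0 < a i) -> (forall i, b i <= 1) ->
    m.+1 <= \sum_(i < m.+1) a i + \sum_(i < m.+1) b i.
  move=> h b1; rewrite -big_split /= -[X in X <= _]card_ord -sum1_card; apply: leq_sum => i _.
  have := h i (leq_ord i); have := b1 i; case: (b i) => [|[|]] //= _; last by lia.
  by move=> /(_ erefl); lia.
have d_le1 x y : differ x y <= 1 by case: x; case: y.
have d0 x y : differ x y = 0 -> x = y by case: x; case: y.
have sx := side (fun i => v i.+1 0) (fun i => d1 i 0) (fun i im e => hx i im (d0 _ _ e)) (fun i
  => d_le1 _ _).
have sy := side (fun j => v 0 j.+1) (fun j => d2 0 j) (fun i im e => hy i im (d0 _ _ e)) (fun i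
  => d_le1 _ _).
have st := side (fun i => v i.+1 (m - i).+1) (fun i => d3 i (m - i))
  (fun i im e => ht i im (d0 _ _ e)) (fun i => d_le1 _ _).
(* The three sides contribute 3(m + 1), while the constant sum grows only by 2(m + 1) from m to m +
   1; the difference is the bound. *)
move: tri inner; rewrite !tri_sumD (tri_sum_col d1) (tri_sum_row d2) (tri_sum_diag d3).
rewrite (tri_sum_diag (fun _ _ => 2)) sum_nat_const card_ord /=.
move: sx sy st => /=.
move: (tri_sum _ m) (tri_sum _ m) (tri_sum _ m) (tri_sum _ m) (tri_sum _ m) => t1 t2 t3 t4 t5.
move: (\sum_(i < _) v _ _) (\sum_(i < _) d1 _ _) (\sum_(i < _) v _ _) (\sum_(i < _) d2 _ _).
move: (\sum_(i < _) v _ _) (\sum_(i < _) d3 _ _) => *; lia.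
Qed.

Local Open Scope ring_scope.

(** * Bivariate polynomials equal to 1 on x + y = 1 *)

Section PlaneCount.
Variables (R : realDomainType) (q g : nat -> nat -> R) (n : nat).
Hypothesis q_vanish : forall a b, (n < a + b)%N -> q a b = 0.
Hypothesis g_ge0 : forall a b, 0 <= g a b.
Hypothesis g_row : forall a, g a.+1 0%N = q a 0%N - q a.+1 0%N.
Hypothesis g_col : forall b, g 0%N b.+1 = q 0%N b - q 0%N b.+1.
Hypothesis g_int : forall a b, g a.+1 b.+1 = q a b.+1 + q a.+1 b - q a.+1 b.+1.

(** Here [q] stands for the coefficients of (1 - g)/(1 - x - y), and n bounds its degree. As g >= 0,
    a positive coefficient needs a positive one directly below it. *)
Lemma positive_pred a b : 0 < q a b -> (0 < a + b)%N ->
  (exists2 a', a = a'.+1 & 0 < q a' b) \/ (exists2 b', b = b'.+1 & 0 < q a b').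
Proof.
move=> qp; case: a b qp => [|a] [|b] qp // _.
- by right; exists b => //; have := g_ge0 0 b.+1; rewrite g_col; lra.
- by left; exists a => //; have := g_ge0 a.+1 0; rewrite g_row; lra.
- have := g_ge0 a.+1 b.+1; rewrite g_int => h.
  have [q1|q1] := ltP 0 (q a b.+1); first by left; exists a.
  by right; exists b => //; lra.
Qed.

(** Descending with [positive_pred] yields a path of positive nodes from the origin; [p j] is its
    x-coordinate in degree j. *)
Lemma positive_path k a : (a <= k)%N -> 0 < q a (k - a) ->
  exists p : nat -> nat, [/\ p k = a,
    forall j, (j <= k)%N -> (p j <= j)%N /\ 0 < q (p j) (j - p j) &
    forall j, (j < k)%N -> (p j <= p j.+1 <= (p j).+1)%N].
Proof.
elim: k a => [|k IH] a ak qp.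
  exists (fun _ => a); split=> // j; rewrite leqn0 => /eqP ->; by [].
have [a' [ak' [qp' st]]] : exists a', (a' <= k)%N /\ 0 < q a' (k - a') /\ (a' <= a <= a'.+1)%N.
  have sz : (0 < a + (k.+1 - a))%N by lia.
  have [[a' ea q1]|[b' eb q1]] := positive_pred qp sz.
    by exists a'; rewrite -[(k - a')%N]subSS -ea; do !split => //; lia.
  by exists a; rewrite (_ : (k - a)%N = b'); [do !split => //; lia|lia].
have [p [pk pos step]] := IH a' ak' qp'.
exists (fun j => if j == k.+1 then a else p j); split; first by rewrite eqxx.
  by move=> j jk; have [->|ne] := eqVneq j k.+1; [|apply: pos; lia].
move=> j jk; rewrite ifN; last by lia.
by have [[->]|ne] := eqVneq j.+1 k.+1; [rewrite pk|apply: step; lia].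
Qed.

(** The first and the last non-zero coefficient of q in degree n each make a contribution in degree
    n + 1 that nothing cancels. The last one is positive, so a path leads to it. *)
Lemma top_terms : (exists2 a, (a <= n)%N & q a (n - a) != 0) ->
  exists a1 a2, [/\ (a1 <= a2 <= n)%N, g a1 (n.+1 - a1) != 0,
    g a2.+1 (n - a2) != 0 & 0 < q a2 (n - a2)].
Proof.
move=> [a an qa].
pose P a := (a <= n)%N && (q a (n - a) != 0).
have exP : exists a, P a by exists a; rewrite /P an.
have [a1 /andP[a1n q1] min1] := ex_minnP exP.
have [|a2 /andP[a2n q2] max2] := ex_maxnP exP (m := n); first by move=> i /andP[].
have g2 : g a2.+1 (n - a2) = q a2 (n - a2).
  have q0 b : (b.+1 = n - a2)%N -> q a2.+1 b = 0.
    move=> e; apply/eqP; apply: contraTT isT => nz.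
    have /max2 : P a2.+1 by rewrite /P (_ : n - a2.+1 = b)%N ?nz ?andbT; lia.
    by rewrite ltnn.
  case e : (n - a2)%N => [|b]; first by rewrite g_row (@q_vanish a2.+1) ?subr0 //; lia.
  by rewrite g_int q0 ?addr0 1?[X in _ - X]q_vanish ?subr0 //; lia.
have g1 : g a1 (n.+1 - a1) = q a1 (n - a1).
  rewrite subSn //; have q0 a' : a'.+1 = a1 -> q a' (n - a1).+1 = 0.
    move=> e; apply/eqP; apply: contraTT isT => nz.
    have /min1 : P a' by rewrite /P (_ : n - a' = (n - a1).+1)%N ?nz ?andbT; lia.
    by lia.
  case e : a1 q0 => [|a'] q0; first by rewrite g_col [X in _ - X]q_vanish ?subr0 //; lia.
  by rewrite g_int q0 // add0r [X in _ - X]q_vanish ?subr0 //; lia.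
exists a1, a2; split; rewrite ?g1 ?g2 //; first by rewrite a2n min1 ?andbT // /P a2n.
by rewrite lt_def q2 -g2 g_ge0.
Qed.

Lemma plane_count : 0 < q 0 0 -> (exists2 a, (a <= n)%N & q a (n - a) != 0) ->
  (n.+2 <= \sum_(i < n.+1) (g i.+1 0 != 0%R) + \sum_(j < n.+1) (g 0 j.+1 != 0%R)
    + 2 * tri_sum (fun i j => g i.+1 j.+1 != 0%R) n)%N.
Proof.
move=> q00 /top_terms[a1 [a2 [/andP[a12 a2n] g1 g2 qa2]]].
have [p [pn pos step]] := positive_path a2n qa2.
(* Zeros are coloured in stripes, by the parity of b to the right of the path and of a to its left.
   A striped region has no unmixed node, and the positive path keeps the two patterns apart. *)
pose s a b := if 0 < q a b then true else if q a b < 0 then false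
  else if (p (a + b) < a)%N then ~~ odd b else ~~ odd a.
have s_true a b : s a b -> 0 <= q a b.
  by rewrite /s; case: ltP => [/ltW //|_]; case: ltP.
have s_false a b : ~~ s a b -> q a b <= 0.
  by rewrite /s; case: ltP => // h.
have path_ne a b : (a + b <= n)%N -> q a b = 0 -> (p (a + b) != a)%N.
  move=> abn q0; apply/eqP => e; have := (pos _ abn).2; rewrite e addKn q0 ltxx //.
have s_zero a b : q a b = 0 -> s a b = if (p (a + b) < a)%N then ~~ odd b else ~~ odd a.
  by rewrite /s => ->; rewrite ltxx.
have le_p a b : (a + b <= n)%N -> (p (a + b) <= a + b)%N by move/pos => [].
pose v a b : nat := g a b != 0.
have v_pos a b : (g a b = 0 -> False) -> (0 < v a b)%N.
  by rewrite /v; case: eqP => // e /(_ e).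
(* [unmixed_nodes] counts the top diagonal once, the goal counts it twice; the second copy and the
   two corners supply the missing 2. *)
have top2 : (2 <= v n.+1 0 + v 0 n.+1 + \sum_(i < n) v i.+1 (n - i))%N.
  have -> : (v n.+1 0 + v 0 n.+1 + \sum_(i < n) v i.+1 (n - i) = \sum_(i < n.+2) v i (n.+1 - i))%N.
    by rewrite -addnA addnC [RHS]big_ord_recr big_ord_recl /= subnn subn0.
  have l1 : (a1 < n.+2)%N by lia.
  have l2 : (a2.+1 < n.+2)%N by lia.
  rewrite (bigD1 (Ordinal l1)) // (bigD1 (Ordinal l2)) /=; last by apply/eqP => -[]; lia.
  by rewrite subSS /v g1 g2.
(* [unmixed_nodes] will be applied with m = n - 1; for n = 0 the bound is [top2] itself. *)
case: n pn pos step a2n path_ne le_p top2 q_vanish => [|m] pn pos step a2n path_ne le_p top2 q_van.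
  by move: top2; rewrite /tri_sum !big_ord0 !big_ord1 !addn0.
have : (m.+1 <= 2 * tri_sum (fun i j => v i.+1 j.+1) m + \sum_(i < m.+1) v i.+1 0
     + \sum_(j < m.+1) v 0 j.+1 + \sum_(i < m.+1) v i.+1 (m - i).+1)%N.
  apply: (@unmixed_nodes s) => [i j ijm e1 e2|i im e|j jm e|i im e]; apply: v_pos => g0.
  - have [z [z1 z2]] : q i.+1 j.+1 = 0 /\ q i j.+1 = 0 /\ q i.+1 j = 0.
      move: g0; rewrite g_int; have [st|sf] := boolP (s i.+1 j.+1).
        have := s_true _ _ st; move: e1 e2; rewrite st => /esym/negbT/s_false h1
          /esym/negbT/s_false h2.
        by move=> h3 h4; do !split; lra.
      have := s_false _ _ sf; move: e1 e2; rewrite sf => /esym/s_true h1 /esym/s_true h2.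
      by move=> h3 h4; do !split; lra.
    have := path_ne _ _ _ z; have := path_ne _ _ _ z1; have := path_ne _ _ _ z2.
    move: e1 e2; rewrite !s_zero // !addSn !addnS => e1 e2 /(_ ltac:(lia)) n2 /(_ ltac:(lia)) n1
      /(_ ltac:(lia)) n0.
    have := step (i + j).+1 ltac:(lia); move: e1 e2 n2 n1 n0 => /=.
    move: (p (i + j).+1) (p (i + j).+2) => P0 P1.
    by case: ltnP => h1; case: ltnP => h2; case: ltnP => h3; case: (odd i);
      case: (odd j) => //=; lia.
  - have [z z1] : q i.+1 0 = 0 /\ q i 0 = 0.
      move: g0; rewrite g_row; have [st|sf] := boolP (s i.+1 0).
        by have := s_true _ _ st; move: e; rewrite st => /esym/negbT/s_false; split; lra.
      by have := s_false _ _ sf; move: e; rewrite sf => /esym/s_true; split; lra.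
    have := path_ne i.+1 0%N ltac:(lia) z; have := path_ne i 0%N ltac:(lia) z1.
    move: e; rewrite !s_zero //= !addn0.
    have := le_p i 0%N ltac:(lia); have := le_p i.+1 0%N ltac:(lia); rewrite !addn0.
    move: (p i) (p i.+1) => P0 P1.
    by case: ltnP => h1; case: ltnP => h2 //=; lia.
  - have [z z1] : q 0 j.+1 = 0 /\ q 0 j = 0.
      move: g0; rewrite g_col; have [st|sf] := boolP (s 0 j.+1).
        by have := s_true _ _ st; move: e; rewrite st => /esym/negbT/s_false; split; lra.
      by have := s_false _ _ sf; move: e; rewrite sf => /esym/s_true; split; lra.
    by move: e; rewrite !s_zero.
  - have z0 : q i.+1 (m - i).+1 = 0 by apply: q_van; lia.
    have [z z1] : q i (m - i).+1 = 0 /\ q i.+1 (m - i) = 0.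
      move: g0; rewrite g_int z0 subr0; have [st|sf] := boolP (s i.+1 (m - i)%N).
        by have := s_true _ _ st; move: e; rewrite st => /s_true; split; lra.
      by have := s_false _ _ sf; move: e; rewrite (negPf sf) => /negbT/s_false; split; lra.
    have := path_ne i (m - i).+1 ltac:(lia) z; have := path_ne i.+1 (m - i)%N ltac:(lia) z1;
      move: e; rewrite !s_zero //=.
    rewrite (_ : i + (m - i).+1 = m.+1)%N; last by lia.
    rewrite (_ : i.+1 + (m - i) = m.+1)%N; last by lia.
    move: (p m.+1) (m - i)%N => P c.
    by case: ltnP => h1; case: ltnP => h2; case: (odd i); case: (odd c) => //=; lia.
have eS : (\sum_(i < m.+1) v i.+1 (m.+1 - i) = \sum_(i < m.+1) v i.+1 (m - i).+1)%N.
  by apply: eq_bigr => i _; rewrite subSn // leq_ord.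
move: top2; rewrite eS tri_sum_diag !(big_ord_recr m.+1) /= -!/(v _ _).
move: (v m.+2 0%N) (v 0%N m.+2) => x y.
move: (\sum_(i < m.+1) v i.+1 (m - i).+1)%N (\sum_(i < m.+1) v i.+1 0)%N (\sum_(i < m.+1) v 0
  i.+1)%N.
move: (tri_sum _ _) => *; lia.
Qed.

End PlaneCount.

Lemma leq_sum_subset (T : eqType) (s s' : seq T) (w : T -> nat) :
  uniq s -> uniq s' -> {subset s <= s'} -> (\sum_(x <- s) w x <= \sum_(x <- s') w x)%N.
Proof.
by apply: (@uniq_sub_le_big nat addn leq leqnn (fun x y => leq_addr y x)).
Qed.

Definition off_axes (p : nat * nat) : nat := ((0 < p.1) + (0 < p.2))%N.

(** The grid nodes of degree 1 to n + 1, split as in [plane_count]. *)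
Definition triangle n : seq (nat * nat) :=
  [seq (i.+1, 0%N) | i <- iota 0 n.+1] ++ [seq (0%N, j.+1) | j <- iota 0 n.+1]
  ++ [seq (i.+1, j.+1) | i <- iota 0 n, j <- iota 0 (n - i)].

Lemma triangle_uniq n : uniq (triangle n).
Proof.
rewrite !cat_uniq; apply/and3P; split.
- by rewrite map_inj_uniq ?iota_uniq // => i j [].
- apply/hasPn => p; rewrite mem_cat => /orP[/mapP[j _ ->]|/allpairsPdep[i [j [_ _ ->]]]];
  by apply/mapP => -[].
apply/and3P; split.
- by rewrite map_inj_uniq ?iota_uniq // => i j [].
- by apply/hasPn => p /allpairsPdep[i [j [_ _ ->]]]; apply/mapP => -[].
by apply: allpairs_uniq_dep => [|i _|[i j] [i' j'] _ _ [-> ->]] //; exact: iota_uniq.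
Qed.

Lemma sum_triangle (f : nat * nat -> nat) n :
  \sum_(p <- triangle n) f p = (\sum_(i < n.+1) f (i.+1, 0%N) + \sum_(j < n.+1) f (0%N, j.+1)
    + tri_sum (fun i j => f (i.+1, j.+1)) n)%N.
Proof.
have iE k : iota 0 k = index_iota 0 k by rewrite /index_iota subn0.
rewrite /triangle 2!big_cat !big_map big_allpairs_dep -[LHS]/(_ + (_ + _))%N addnA.
rewrite /tri_sum !iE !big_mkord.
by congr (_ + _)%N; apply: eq_bigr => i _; rewrite iE big_mkord.
Qed.

(** The outer variable is x, so [P.[1 - 'X]] is P on the line x + y = 1, and P has degree at most
    one more than the quotient bounded by [plane_count]. The first zero of q along each axis gives a
    pure power in P. *)
Lemma poly_plane_count (R : realDomainType) (P : {poly {poly R}}) (s : seq (nat * nat)) :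
  (forall a b, 0 <= P`_a`_b) -> P`_0`_0 = 0 -> P.[1 - 'X] = 1 ->
  uniq s -> (forall a b, P`_a`_b != 0 -> (a, b) \in s) ->
  [/\ forall a b, P`_a`_b != 0 -> (a + b < \sum_(p <- s) off_axes p)%N,
      exists a, P`_a.+1`_0 != 0 & exists b, P`_0`_b.+1 != 0].
Proof.
move=> P_ge0 P00 P1 us supp.
have : root (1 - P) (1 - 'X) by rewrite /root hornerD hornerN hornerC P1 subrr.
move=> /factor_theorem[Q eQ].
(* The factor theorem divides by x - (1 - y); the sign turns this into division by 1 - x - y. *)
pose q a b := (- Q)`_a`_b.
have eP : P = 1 + Q * (1 - 'X%:P - 'X).
  rewrite -[LHS](subKr 1) eQ rmorphB rmorph1 -mulrN; congr (_ + _ * _); ring.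
have coefP a b : P`_a`_b = ((a == 0%N) && (b == 0%N))%:R - q a b
   + (if a is a'.+1 then q a' b else 0) + (if b is b'.+1 then q a b' else 0).
  rewrite eP !mulrBr mulr1 /q.
  case: a b => [|a] [|b]; rewrite !(coefD, coefN, coefMX, coefMC, coef1) /=;
  by rewrite ?(coefD, coefN, coefMX, coefMC, coef1, coef0) /=; ring.
have q00 : q 0%N 0%N = 1 by have := coefP 0%N 0%N; rewrite P00 /=; lra.
have [K qK] : exists K, forall a b, q a b != 0 -> (a + b <= K)%N.
  pose bB := \max_(i < size Q) size (Q`_i)%R; exists (size Q + bB)%N => a b nz.
  have la : (a < size Q)%N.
    by rewrite ltnNge; apply: contra nz => /(nth_default 0) e; rewrite /q coefN e oppr0 coef0.
  have lb : (b < size (Q`_a)%R)%N.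
    by rewrite ltnNge; apply: contra nz => /(nth_default 0) e; rewrite /q !coefN e oppr0.
  have : (size (Q`_a)%R <= bB)%N by exact: (leq_bigmax (Ordinal la)).
  by move: la lb; move: (size _) bB (size _); lia.
pose M k := [exists a : 'I_K.+1, (a <= k)%N && (q a (k - a)%N != 0)].
have M0 : exists k, M k by exists 0%N; apply/existsP; exists ord0; rewrite /= q00 oner_neq0.
have [|n Mn maxn] := ex_maxnP M0 (m := K).
  by move=> k /existsP[a /andP[ak /qK]]; rewrite subnKC.
have q_vanish a b : (n < a + b)%N -> q a b = 0.
  move=> nab; apply/eqP; apply: contraTT nab => nz; rewrite -leqNgt; apply: maxn.
  have aK : (a < K.+1)%N by have := qK a b nz; lia.
  by apply/existsP; exists (Ordinal aK); rewrite /= leq_addr addKn.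
pose g a b := P`_a`_b.
have : (n.+2 <= \sum_(i < n.+1) (g i.+1 0 != 0%R) + \sum_(j < n.+1) (g 0 j.+1 != 0%R)
    + 2 * tri_sum (fun i j => g i.+1 j.+1 != 0%R) n)%N.
  apply: (@plane_count R q g n q_vanish P_ge0).
  - by move=> a; rewrite /g coefP /=; ring.
  - by move=> a; rewrite /g coefP /=; ring.
  - by move=> a b; rewrite /g coefP /=; ring.
  - by rewrite q00.
  - by move/existsP: Mn => [a /andP[an nz]]; exists (a : nat).
move=> count; pose w p : nat := (off_axes p * (g p.1 p.2 != 0%R))%N.
have count_s : (n.+2 <= \sum_(p <- s) off_axes p)%N.
  apply: leq_trans (_ : \sum_(p <- triangle n) w p <= _)%N.
    rewrite sum_triangle /w /= (leq_trans count) // leq_add //.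
      by rewrite leq_add //; apply: leq_sum => i _; rewrite mul1n.
    by rewrite mul2n -addnn -tri_sumD; apply: leq_tri_sum => i j _; case: eqP.
  rewrite (bigID (fun p : nat * nat => g p.1 p.2 != 0)) /= addnC big1 ?add0n; last first.
    by move=> p /negPn/eqP e; rewrite /w e eqxx muln0.
  rewrite -big_filter; apply: (@leq_trans (\sum_(p <- [seq p <- triangle n | g p.1 p.2 != 0%R])
    off_axes p)%N).
    by rewrite leq_sum // => p _; rewrite /w; case: (_ != _); rewrite ?muln1 ?muln0.
  apply: leq_sum_subset => // [|[a b]]; first by rewrite filter_uniq // triangle_uniq.
  by rewrite mem_filter => /andP[/supp].
split.
- move=> a b nz; apply: leq_trans count_s; rewrite ltnS leqNgt; apply: contra nz => lt.
  rewrite coefP q_vanish ?subr0; last by lia.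
  by case: a b lt => [|a] [|b] lt /=; rewrite ?q_vanish ?addr0 ?subr0 //; lia.
- have ex0 : exists a, q a 0%N == 0 by exists n.+1; rewrite q_vanish ?addn0.
  have [[|a] /eqP qa min_a] := ex_minnP ex0; first by move: qa; rewrite q00 => /eqP;
    rewrite oner_eq0.
  exists a; rewrite coefP /= qa subr0 add0r addr0; apply: contraT => /negPn /min_a.
  by rewrite ltnn.
- have ex0 : exists b, q 0%N b == 0 by exists n.+1; rewrite q_vanish ?add0n.
  have [[|b] /eqP qb min_b] := ex_minnP ex0; first by move: qb; rewrite q00 => /eqP;
    rewrite oner_eq0.
  exists b; rewrite coefP /= qb subr0 !add0r; apply: contraT => /negPn /min_b.
  by rewrite ltnn.
Qed.

(** * Search over sign patterns *)

Local Close Scope ring_scope.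

Inductive sign := Zero | Plus | Minus.
(* [role_of v w] is the sign with which the coefficient [h w] enters that of the monomial [v]
   of G = 1 - (1 - Phi) H: positive if v lies in w + supp Phi, negative if v = w. *)
Inductive role := Absent | Source | Self.
Inductive status := Empty | Positive | Negative | Mixed.

Fixpoint eval_node (m : seq role) (st : seq sign) (s : status) : status :=
  match m, st with
  | r :: m', x :: st' =>
    match r, x with
    | Absent, _ | _, Zero => eval_node m' st' s
    | Source, Plus | Self, Minus =>
      match s with Negative | Mixed => Mixed | _ => eval_node m' st' Positive end
    | Source, Minus | Self, Plus =>
      match s with Positive | Mixed => Mixed | _ => eval_node m' st' Negative end
    end
  | _, _ => s
  end.

(** [None] closes a branch: a coefficient of G would be negative, or the forced monomials exceed the
    budget. Otherwise the remaining budget is returned. *)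
Fixpoint check_nodes (ns : seq (nat * seq role)) (st : seq sign) (b : nat) : option nat :=
  match ns with
  | [::] => Some b
  | (w, m) :: ns' =>
    match eval_node m st Empty with
    | Negative => None
    | Positive => if w <= b then check_nodes ns' st (b - w) else None
    | _ => check_nodes ns' st b
    end
  end.

Definition flags := (nat * nat * nat)%type.
Definition max_flags (f t : flags) : flags :=
  (maxn f.1.1 t.1.1, maxn f.1.2 t.1.2, maxn f.2 t.2).
Definition sum_flags (f : flags) := f.1.1 + f.1.2 + f.2.

(** The bottom of the stack is the constant coefficient of H, which is 1; hence the final [Plus]. *)
Fixpoint all_zero (st : seq sign) :=
  match st with Zero :: st' => all_zero st' | [:: Plus] => true | _ => false end.

(* A plan lists the variables in the order in which they get a sign, each with the weighted
   nodes decided by it.  The budget [b] pays for nodes that are certainly monomials of G and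
   for the increase of the flags [f], lower bounds for the weights of the three faces. *)
Fixpoint search (pl : seq (flags * seq (nat * seq role))) st b (f : flags) : bool :=
  match pl with
  | [::] => all_zero st
  | (t, ns) :: pl' =>
    let try x :=
      let f' := match x with Zero => f | _ => max_flags f t end in
      let inc := sum_flags f' - sum_flags f in
      if inc <= b then
        match check_nodes ns (x :: st) (b - inc) with
        | None => true
        | Some b' => search pl' (x :: st) b' f'
        end
      else true in
    try Zero && try Plus && try Minus
  end.

Definition Phi_expos := [seq t.1 | t <- Phi_terms].
Definition origin : expo := (0, 0, 0).
Definition role_of (v w : expo) : role :=
  if w == v then Self else if v \in [seq add_expo w s | s <- Phi_expos] then Source else Absent.
Definition touches (v w : expo) := (w == v) || (v \in [seq add_expo w s | s <- Phi_expos]).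

(** A node is evaluated as soon as no remaining variable touches it; its roles follow the order of
    the stack. *)
Fixpoint make_plan (weight_of : expo -> nat) (flags_of : expo -> flags)
    (stk vs ns : seq expo) : seq (flags * seq (nat * seq role)) :=
  match vs with
  | [::] => [::]
  | v :: vs' =>
    (flags_of v, [seq (weight_of n, [seq role_of n w | w <- v :: stk])
       | n <- [seq n <- ns | ~~ has (touches n) vs']])
    :: make_plan weight_of flags_of (v :: stk) vs' [seq n <- ns | has (touches n) vs']
  end.

Local Open Scope ring_scope.

(** * Soundness of the search *)

Section Soundness.
Variables (R : realDomainType) (g h : expo -> R).
Hypothesis bal : balanced g h.
Variables (weight_of : expo -> nat) (flags_of : expo -> flags).

Definition sign_of (x : R) : sign := if 0 < x then Plus else if x < 0 then Minus else Zero.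

Definition node_coef (v w : expo) : R :=
  \sum_(t <- Phi_terms | add_expo w t.1 == v) t.2%:R - (w == v)%:R.

Lemma shifted_sum (stk : seq expo) v s : uniq stk -> s \in Phi_expos ->
  (forall w, h w != 0 -> touches v w -> w \in stk) ->
  shifted h v s = \sum_(w <- stk | add_expo w s == v) h w.
Proof.
move=> us sPhi sup; rewrite /shifted; case: ifP => [/and3P[l1 l2 l3]|nle].
  have e : add_expo (sub_expo v s) s = v.
    by rewrite /add_expo /sub_expo /= !subnK // -!surjective_pairing.
  rewrite (eq_bigl (pred1 (sub_expo v s))) => [|w]; last first.
    apply/eqP/eqP => [<-|->] //; case: w {e l1 l2 l3} => -[a b] c.
    by rewrite /add_expo /sub_expo /= !addnK.
  have [m|nm] := boolP (sub_expo v s \in stk);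
    first by rewrite -big_filter filter_pred1_uniq // big_seq1.
  rewrite big_seq_cond big1 => [|w /andP[ws /eqP e']]; last by rewrite -e' ws in nm.
  apply/eqP; apply: contraNT nm => nz; apply: sup => //.
  by apply/orP; right; rewrite -{1}e; apply: map_f.
rewrite big1 // => w /eqP e; move: nle.
by rewrite -e /le_expo /add_expo /= !leq_addl.
Qed.

Lemma node_sum (stk : seq expo) v : uniq stk -> v != origin ->
  (forall w, h w != 0 -> touches v w -> w \in stk) ->
  g v = \sum_(w <- stk) node_coef v w * h w.
Proof.
move=> us v0 sup; rewrite (balanced_eq bal) (negPf v0) add0r.
rewrite (eq_bigr (fun w => \sum_(t <- Phi_terms | add_expo w t.1 == v) t.2%:R * h w - (w ==
  v)%:R * h w)).
  rewrite sumrB; congr (_ - _).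
    rewrite (eq_bigr (fun w => \sum_(t <- Phi_terms) if add_expo w t.1 == v then t.2%:R * h w
      else 0)).
      rewrite exchange_big /= big_seq [RHS]big_seq; apply: eq_bigr => t tP.
      rewrite -big_mkcond /= -mulr_sumr (@shifted_sum stk) //.
      by apply: map_f.
    by move=> w _; rewrite big_mkcond.
  have [m|nm] := boolP (v \in stk).
    rewrite (bigD1_seq v) //= eqxx mul1r big1 ?addr0 // => w /negPf ->; exact: mul0r.
  rewrite big_seq big1 => [|w ws]; last by case: eqP => [e|_]; rewrite ?mul0r // -e ws in nm *.
  apply/eqP; apply: contraNT nm => nz; apply: sup => //; by rewrite /touches eqxx.
by move=> w _; rewrite /node_coef mulrBl mulr_suml.
Qed.

Definition describes (s : status) (x : R) : Prop :=
  match s with Empty => x = 0 | Positive => 0 < x | Negative => x < 0 | Mixed => True end.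

Lemma role_coef v w : match role_of v w with
  | Absent => node_coef v w = 0 | Source => 0 < node_coef v w | Self => node_coef v w < 0 end.
Proof.
have Phi_pos : all (fun t => (0 < t.2) && (t.1 != origin))%N Phi_terms by [].
rewrite /role_of /node_coef; have [<-|ne] := eqVneq w v.
  rewrite big_seq_cond big1 ?sub0r ?oppr_lt0 // => t /andP[/(allP Phi_pos)/andP[_ t0] /eqP e].
  case/eqP: t0; move: e; case: w t => -[a b] c [[[a' b'] c'] r] [] /=; rewrite /origin.
  by move=> *; congr (_, _, _); lia.
rewrite subr0; case: ifP => [/mapP[s /mapP[t tP ->] e]|/negbT nin].
  rewrite (big_rem t) //= e eqxx ltr_wpDr //; last by rewrite ltr0n; case/andP: (allP Phi_pos _ tP).
  by apply: sumr_ge0 => u _; rewrite ler0n.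
rewrite big_seq_cond big1 // => t /andP[tP /eqP e]; case/negP: nin.
by rewrite -e; apply: map_f; apply: map_f.
Qed.

Lemma eval_node_sound v stk s x : describes s x ->
  describes (eval_node [seq role_of v w | w <- stk] [seq sign_of (h w) | w <- stk] s)
    (x + \sum_(w <- stk) node_coef v w * h w).
Proof.
elim: stk s x => [|w stk IH] s x /=; first by rewrite big_nil addr0.
move=> ds; rewrite big_cons addrA; have := role_coef v w; move: (node_coef v w) => c.
case: (role_of v w) => hc; rewrite /sign_of; case: (ltgtP 0 (h w)) => hw /=;
  do ?[by apply: IH; rewrite ?hc ?mul0r ?hw ?mulr0 ?addr0];
  case: s ds => //= ds; apply: IH => /=; rewrite -?hw; nra.
Qed.

Definition cost (ns : seq expo) : nat := (\sum_(n <- ns) weight_of n * (g n != 0%R))%N.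

(** [rest] is what later nodes and flags will still need; with the true signs of h, a budget
    covering both is never exhausted. *)
Lemma check_nodes_sound ns stk b rest :
  uniq stk ->
  {in ns, forall n, n != origin /\ forall w, h w != 0 -> touches n w -> w \in stk} ->
  (cost ns + rest <= b)%N ->
  exists2 b', check_nodes [seq (weight_of n, [seq role_of n w | w <- stk]) | n <- ns]
                [seq sign_of (h w) | w <- stk] b = Some b' & (rest <= b')%N.
Proof.
move=> us; elim: ns b => [|n ns IH] b sup; first by rewrite /cost big_nil; exists b.
have sup' : {in ns, forall n, n != origin /\ forall w, h w != 0 -> touches n w -> w \in stk}.
  by move=> k ks; apply: sup; rewrite inE ks orbT.
have [n0 supn] := sup n (mem_head _ _).
rewrite /cost big_cons -/(cost ns) => budget /=.
have := @eval_node_sound n stk Empty 0 erefl; rewrite add0r -node_sum //.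
case: eval_node => /= gn.
- by apply: IH => //; lia.
- move: budget; rewrite (gt_eqF gn) muln1 => budget.
  by rewrite ifT; [apply: IH => //|]; lia.
- by have := balanced_ge0 bal n; rewrite leNgt gn.
by apply: IH => //; lia.
Qed.

Definition final_flags (f : flags) (vs : seq expo) : flags :=
  foldl (fun f v => if h v == 0 then f else max_flags f (flags_of v)) f vs.

Lemma sum_max_flags f t : (sum_flags f <= sum_flags (max_flags f t))%N.
Proof. by rewrite /sum_flags /max_flags /=; lia. Qed.

Lemma sum_final_flags f vs : (sum_flags f <= sum_flags (final_flags f vs))%N.
Proof.
elim: vs f => [|v vs IH] f //=; apply: leq_trans (IH _).
by case: eqP => // _; exact: sum_max_flags.
Qed.

(** The branch following the true signs of h is never closed, since g >= 0 and its real cost fits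
    the budget. It therefore reaches a leaf, where [all_zero] is tested on these signs. *)
Lemma search_sound vs stk ns b f :
  search (make_plan weight_of flags_of stk vs ns) [seq sign_of (h w) | w <- stk] b f ->
  uniq (catrev vs stk) ->
  {in ns, forall n, n != origin /\
    forall w, h w != 0 -> touches n w -> (w \in stk) || (w \in vs)} ->
  (cost ns + sum_flags (final_flags f vs) <= b + sum_flags f)%N ->
  all_zero [seq sign_of (h w) | w <- catrev vs stk].
Proof.
elim: vs stk ns b f => [|v vs IH] stk ns b f //= tries us sup budget.
set f' := if h v == 0 then f else max_flags f (flags_of v) in budget.
have : let inc := (sum_flags f' - sum_flags f)%N in
  if (inc <= b)%N then
    match check_nodes [seq (weight_of n, [seq role_of n w | w <- v :: stk])
             | n <- [seq n <- ns | ~~ has (touches n) vs]]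
             [seq sign_of (h w) | w <- v :: stk] (b - inc)%N with
    | None => true
    | Some b' => search (make_plan weight_of flags_of (v :: stk) vs [seq n <- ns | has (touches
      n) vs])
        [seq sign_of (h w) | w <- v :: stk] b' f'
    end
  else true.
  move: tries => /andP[/andP[tz tp] tm] /=; rewrite /f' /sign_of.
  by case: ltgtP => // ->; rewrite eqxx.
have ff' : (sum_flags f <= sum_flags f')%N.
  by rewrite /f'; case: eqP => // _; exact: sum_max_flags.
have f'f := sum_final_flags f' vs.
have cost_split : cost ns = (cost [seq n <- ns | ~~ has (touches n) vs]
    + cost [seq n <- ns | has (touches n) vs])%N.
  by rewrite /cost !big_filter addnC [LHS](bigID (fun n => has (touches n) vs)).
rewrite /= ifT; last by lia.
have [|||b' -> rest] := @check_nodes_sound [seq n <- ns | ~~ has (touches n) vs] (v :: stk)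
   (b - (sum_flags f' - sum_flags f))%N
   (cost [seq n <- ns | has (touches n) vs] + sum_flags (final_flags f' vs) - sum_flags f')%N.
- by move: us; rewrite catrevE cat_uniq => /and3P[].
- move=> n; rewrite mem_filter => /andP[/hasPn nt /sup[n0 supn]]; split=> // w hw tw.
  have := supn w hw tw; rewrite !inE => /or3P[ws|/eqP ->|wvs]; rewrite ?ws ?eqxx ?orbT //.
  by case/negP: (nt _ wvs).
- by lia.
move/IH; apply=> //; last by lia.
move=> n; rewrite mem_filter => /andP[_ /sup[n0 supn]]; split=> // w hw tw.
by have := supn w hw tw; rewrite !inE => /or3P[->|->|->]; rewrite ?orbT.
Qed.

End Soundness.

Local Close Scope ring_scope.

(** * The two instances of the search *)

(** The candidates left by [bounded_expo] other than the origin, in non-increasing degree. *)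
Definition main_vars : seq expo :=
  [:: (4,4,4); (1,3,7); (2,5,4); (3,7,1); (4,2,5); (5,4,2); (7,1,3);
      (0,6,4); (4,0,6); (6,4,0); (1,1,8); (1,8,1); (2,3,5); (3,5,2); (5,2,3); (8,1,1);
      (0,4,5); (4,5,0); (5,0,4); (1,6,2); (2,1,6); (3,3,3); (6,2,1);
      (0,2,6); (2,6,0); (6,0,2); (1,4,3); (3,1,4); (4,3,1);
      (0,0,7); (0,7,0); (7,0,0); (1,2,4); (2,4,1); (4,1,2);
      (0,5,1); (1,0,5); (5,1,0); (2,2,2); (0,3,2); (2,0,3); (3,2,0);
      (0,1,3); (1,3,0); (3,0,1); (1,1,1)].

Definition nodes_of (vs : seq expo) : seq expo :=
  undup (vs ++ [seq add_expo w s | w <- origin :: vs, s <- Phi_expos]).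

(* [face_search] excludes a weight below 15 on a face where H is not constant. *)
Definition face_bound d := if d == 0 then 8 else maxn 15 (d + 8).

(** A coefficient of H on a face forces the weight of that face; the entries belong to x = 0, y = 0
    and z = 0. *)
Definition main_flags (v : expo) : flags :=
  let t := face_bound (deg_expo v) in
  (if v.1.1 == 0 then t else 0, if v.1.2 == 0 then t else 0, if v.2 == 0 then t else 0).

(** Monomials on a face are paid for by the flags, so they are free here. *)
Definition main_weight (v : expo) : nat :=
  if [&& 0 < v.1.1, 0 < v.1.2 & 0 < v.2] then 2 else 0.

Definition main_plan :=
  Eval vm_compute in make_plan main_weight main_flags [:: origin] main_vars (nodes_of main_vars).

Lemma main_planE :
  make_plan main_weight main_flags [:: origin] main_vars (nodes_of main_vars) = main_plan.
Proof. by vm_compute. Qed.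

(* The budget is 2 * 28 - 3 * 8: an interior monomial weighs 2, and each face weighs at least 8. *)
Lemma main_search :
  search (make_plan main_weight main_flags [:: origin] main_vars (nodes_of main_vars))
    [:: Plus] 32 (8, 8, 8).
Proof. by rewrite main_planE; vm_compute. Qed.

Definition face_vars : seq expo := [:: (5,1,0); (3,2,0); (1,3,0)].

Definition face_weight (v : expo) : nat := (0 < v.1.1) + (0 < v.1.2).

Definition face_nodes : seq expo := [seq n <- nodes_of face_vars | n.2 == 0].

(** A face of weight at most 14 leaves H of degree at most 14 - 8 = 6 there, hence only [face_vars]
    besides the origin. *)
Lemma face_search :
  search (make_plan face_weight (fun _ => (0, 0, 0)) [:: origin] face_vars face_nodes)
    [:: Plus] 14 (0, 0, 0).
Proof. by vm_compute. Qed.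

Local Open Scope ring_scope.

(** * Bounds on the support of the quotient *)

Definition rotate (v : expo) : expo := (v.1.2, v.2, v.1.1).

Lemma rotate3 v : rotate (rotate (rotate v)) = v.
Proof. by case: v => -[a b] c. Qed.

(** Phi is invariant under cyclic shifts, and the weight of [rotate v] is 4 times that of v modulo
    7. *)
Lemma balanced_rotate (R : realDomainType) (g h : expo -> R) :
  balanced g h -> balanced (g \o rotate) (h \o rotate).
Proof.
move=> bal; split=> [v|v|||v] /=.
- exact: balanced_ge0 bal _.
- rewrite (balanced_eq bal); congr (_%:R + _ - _).
    by rewrite /rotate; case: v => -[a b] c; rewrite !xpair_eqE /= andbC andbA.
  have pPhi : perm_eq Phi_terms [seq (rotate t.1, t.2) | t <- Phi_terms] by [].
  rewrite (perm_big _ pPhi) big_map; apply: eq_bigr => t _ /=; congr (_ * _).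
  rewrite /shifted /le_expo /rotate /=.
  by case: (t.1.1.1 <= _)%N; case: (t.1.1.2 <= _)%N; case: (t.1.2 <= _)%N.
- exact: balanced_h0 bal.
- have [K hK] := balanced_finite bal; exists K => v /= /hK; rewrite /deg_expo /rotate /=; lia.
- have := balanced_weight bal (v := rotate v); move=> hh /hh; rewrite /weight /rotate /=; lia.
Qed.

(* The element of the support of h in D with the largest (l, x-degree), multiplied by x^7,
   cannot cancel. *)
Lemma extremal_term (R : realDomainType) (g h : expo -> R) (D : pred expo) (l : expo -> nat)
    (l1 l2 l3 : nat) :
  balanced g h ->
  (forall v, l v = l1 * v.1.1 + l2 * v.1.2 + l3 * v.2)%N ->
  (forall v w, D (add_expo v w) = D v && D w) -> D (7, 0, 0)%N ->
  all (fun s => D s ==> ((l s < l (7, 0, 0))%N || (l s == l (7, 0, 0)%N) && (s.1.1 < 7)%N))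
    (behead Phi_expos) ->
  forall v, D v -> h v != 0 -> exists w, [/\ D w, g w != 0 & (l v + 7 * l1 <= l w)%N].
Proof.
move=> bal lE DD D7 lPhi v Dv hv; have [K hK] := balanced_finite bal.
(* [K.+1] exceeds every x-degree in the support of h, so there [key] is the lexicographic order on
   (l, x-degree). *)
pose key v := (K.+1 * l v + v.1.1)%N.
pose cand := [seq (p.1, p.2.1, p.2.2) | p <- [seq (a, p) | a <- iota 0 K,
   p <- [seq (b, c) | b <- iota 0 K, c <- iota 0 K]]] : seq expo.
have in_cand u : h u != 0 -> u \in cand.
  move=> /hK; case: u => -[a b] c; rewrite /deg_expo /= => lt.
  apply/mapP; exists (a, (b, c)) => //; apply: allpairs_f; rewrite ?mem_iota ?add0n; first by lia.
  by apply: allpairs_f; rewrite mem_iota; lia.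
pose P k := has (fun u => [&& D u, h u != 0 & key u == k]) cand.
have exP : exists k, P k by exists (key v); apply/hasP; exists v; rewrite ?in_cand // Dv hv /=.
have keyD u w : key (add_expo u w) = (key u + key w)%N by rewrite /key !lE /=; lia.
have [|k /hasP[u _ /and3P[Du hu /eqP uk]] max_k] := ex_maxnP exP (m := (K.+1 * (l1 + l2 + l3) *
  K + K)%N).
  move=> k /hasP[u _ /and3P[_ /hK]]; rewrite /deg_expo => lt /eqP <-; rewrite /key lE; nia.
have max_u w : D w -> h w != 0 -> (key w <= key u)%N.
  by move=> Dw hw; rewrite uk; apply: max_k; apply/hasP; exists w; rewrite ?in_cand // Dw hw /=.
have zero w : D w -> (key u < key w)%N -> h w = 0.
  by move=> Dw; rewrite ltnNge => lt; apply/eqP; apply: contraNT lt; exact: max_u.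
have key7 : (0 < key (7, 0, 0))%N by rewrite /key /=; lia.
have ne0 : (add_expo u (7, 0, 0)%N == (0, 0, 0)%N) = false.
  by apply/eqP => e; have := congr1 (fun w : expo => w.1.1) e; rewrite /=; lia.
exists (add_expo u (7, 0, 0)%N); split.
- by rewrite DD Du.
- rewrite (balanced_eq bal) [_ == _]/=.
  rewrite (zero (add_expo u (7, 0, 0)%N)) ?DD ?Du ?D7 // ?keyD; last by lia.
  rewrite -[Phi_terms]/(((7, 0, 0)%N, 1%N) :: behead Phi_terms) big_cons big1_seq => [|t /andP[_
    tP]].
    rewrite /shifted /le_expo /= leq_addl !leq0n /= addr0 subr0 mul1r /sub_expo /= addnK !addn0
      !subn0.
    by rewrite ne0 add0r -!surjective_pairing.
  have sP : t.1 \in behead Phi_expos by exact: map_f tP.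
  rewrite /shifted; case: ifP => [/and3P[/= l1' l2' l3']|_]; last by rewrite mulr0.
  set w := sub_expo _ _; have e : add_expo w t.1 = add_expo u (7, 0, 0)%N.
    by rewrite /w /add_expo /sub_expo /= !subnK.
  have /andP[Dw Ds] : D w && D t.1 by rewrite -DD e DD Du.
  rewrite (zero w) ?mulr0 //.
  have := keyD w t.1; rewrite e keyD => ek.
  (* Any other monomial of Phi in D has a smaller key than x^7, so w lies above the maximum u and h
     vanishes at w. *)
  have : (key t.1 < key (7, 0, 0))%N.
    have a7 : (t.1.1.1 <= 7)%N by move: t tP {sP l1' l2' l3' w e Dw Ds ek}; apply/allP.
    rewrite /key [(7, 0, 0)%N.1.1]/=.
    have /implyP/(_ Ds)/orP[lt|/andP[/eqP -> lt]] := allP lPhi _ sP; last by rewrite ltn_add2l.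
    have : (K.+1 * (l t.1).+1 <= K.+1 * l (7, 0, 0)%N)%N by rewrite leq_mul2l lt.
    by move: a7; rewrite mulnS; move: (K.+1 * l t.1)%N (K.+1 * _)%N (t.1.1.1); clear; lia.
  by lia.
rewrite lE /= -lE; have := max_u v Dv hv; rewrite /key.
have := hK u hu; rewrite /deg_expo => uK; rewrite !lE /= in uk *.
by nia.
Qed.

Lemma coef_monomial2 (R : comNzRingType) (c : R) i j a b :
  ((c%:P)%:P * ('X ^+ i * 'X%:P ^+ j) : {poly {poly R}})`_a`_b =
  c * ((i == a) && (j == b))%:R.
Proof.
have -> : (c%:P)%:P * ('X ^+ i * 'X%:P ^+ j) = (c%:P * 'X^j)%:P * 'X^i :> {poly {poly R}}.
  by rewrite rmorphM rmorphXn /=; ring.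
rewrite coefCM coefXn eq_sym; case: eqP => _ /=; last by rewrite mulr0 coef0 mulr0.
by rewrite mulr1 coefCM coefXn eq_sym.
Qed.

Definition exponents (R : Type) (L : seq (expo * R)) : seq expo := [seq t.1 | t <- L].

Definition plane_unit (R : realDomainType) (L : seq (expo * R)) : Prop :=
  [/\ uniq (exponents L), all (fun t => 0 < t.2) L, (0, 0, 0)%N \notin exponents L &
      forall x y z, x + y + z = 1 -> ev id x y z L = 1].

Definition rotate_terms (R : Type) (L : seq (expo * R)) := [seq (rotate t.1, t.2) | t <- L].

Lemma exponents_rotate (R : Type) (L : seq (expo * R)) :
  exponents (rotate_terms L) = [seq rotate v | v <- exponents L].
Proof. by rewrite /exponents /rotate_terms -!map_comp. Qed.

Lemma plane_unit_rotate (R : realDomainType) (L : seq (expo * R)) :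
  plane_unit L -> plane_unit (rotate_terms L).
Proof.
move=> [uL posL L0 plane]; split.
- by rewrite exponents_rotate map_inj_uniq // => u v e; rewrite -(rotate3 u) e rotate3.
- by rewrite all_map.
- rewrite exponents_rotate; apply: contra L0 => /mapP[[[a b] c] vL [eb ec ea]].
  by move: vL; rewrite -eb -ec -ea.
- move=> x y z s1; rewrite -[RHS](plane z x y); last by rewrite -s1; ring.
  by rewrite /ev big_map; apply: eq_bigr => t _ /=; ring.
Qed.

Definition face_count (K : seq expo) : nat := (\sum_(v <- K | v.2 == 0%N) off_axes v.1)%N.

(** Setting z = 0 leaves a polynomial equal to 1 on x + y = 1, to which [poly_plane_count]
    applies. *)
Lemma face_degree (R : realDomainType) (L : seq (expo * R)) v :
  plane_unit L -> v \in exponents L -> v.2 = 0%N -> (v.1.1 + v.1.2 < face_count (exponents L))%N.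
Proof.
move=> [uL posL L0 plane] vL v2.
pose P := ev C2 'X 'X%:P 0 L.
have coefP a b : P`_a`_b = \sum_(t <- L) t.2 * (t.1 == (a, b, 0%N))%:R.
  rewrite /P /ev !coef_sum; apply: eq_bigr => -[[[a' b'] c'] r] _ /=.
  rewrite mulrA -[_ * ('X^a' * _)]/(_ * _) expr0n; case: c' => [|c'].
    by rewrite mulr1 coef_monomial2 !xpair_eqE andbT.
  by rewrite mulr0 !coef0 !xpair_eqE andbF mulr0.
pose s := [seq v.1 | v <- exponents L & v.2 == 0%N].
have [|||||/(_ v.1.1 v.1.2) + _ _] := @poly_plane_count R P s.
- by move=> a b; rewrite coefP big_seq; apply: sumr_ge0 => t /(allP posL) t0;
  rewrite mulr_ge0 ?ler0n // ltW.
- rewrite coefP big_seq big1 // => t tL; case: eqP => [e|]; rewrite ?mulr0 //.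
  by case/negP: L0; rewrite -e; apply: map_f.
- rewrite -[LHS]/(horner_eval _ _) rmorph_ev /= /horner_eval !hornerE.
  rewrite (@eq_ev _ _ _ polyC) => [|r /=]; last by rewrite hornerE.
  by apply: ev_plane => //; ring.
- rewrite map_inj_in_uniq ?filter_uniq // => -[x i] [y j]; rewrite !mem_filter /=.
  by move=> /andP[/eqP -> _] /andP[/eqP -> _] ->.
- move=> a b; rewrite coefP big_seq => nz; apply/mapP.
  exists (a, b, 0%N) => //; rewrite mem_filter /=; apply: contraNT nz => nL.
  rewrite big1 // => t tL; case: eqP => [e|]; rewrite ?mulr0 //.
  by case/negP: nL; rewrite -e; apply: map_f.
rewrite /face_count -(big_filter _ (fun v : expo => v.2 == 0%N)) -(big_map fst xpredT off_axes).
apply; rewrite coefP; have [t tL et] := mapP vL.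
rewrite (big_rem t) //= gt_eqF // ltr_wpDr //.
  rewrite big_seq; apply: sumr_ge0 => u /mem_rem/(allP posL) u0; rewrite mulr_ge0 ?ler0n // ltW //.
by rewrite -et -v2 -!surjective_pairing eqxx mulr1; apply: (allP posL).
Qed.

(** The two pure powers weigh 1, every other node at most 2. *)
Lemma sum_off_axes (s : seq (nat * nat)) a b :
  uniq s -> (a.+1, 0%N) \in s -> (0%N, b.+1) \in s ->
  (\sum_(p <- s) off_axes p + 2 <= 2 * size s)%N.
Proof.
move=> us sa sb; rewrite (big_rem _ sa) /=.
have sb' : (0%N, b.+1) \in rem (a.+1, 0%N) s by rewrite mem_rem_uniq // inE sb.
rewrite (big_rem _ sb') /=; set r := rem _ _.
have : (\sum_(p <- r) off_axes p <= 2 * size r)%N.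
  elim: r => [|p r IH]; rewrite ?big_nil // big_cons /= mulnS leq_add //.
  by rewrite /off_axes; case: (0 < p.1)%N; case: (0 < p.2)%N.
rewrite /r !size_rem //.
have : (0 < size (rem (a.+1, 0%N) s))%N by rewrite lt0n size_eq0; apply: contraTneq sb' => ->.
rewrite size_rem //; move: (\sum_(p <- _) _) => X; rewrite /off_axes /=; lia.
Qed.

(* The map (x, y, z) -> (u^3, 3uv, v^3) sends the line u + v = 1 into the plane
   x + y + z = 1, because (u + v)^3 = u^3 + 3uv(u + v) + v^3; it merges monomials
   but multiplies the degree by up to 3. *)
Lemma degree_bound (R : realDomainType) (L : seq (expo * R)) (v : expo) :
  plane_unit L -> v \in exponents L ->
  (3 * v.1.1 + 2 * v.1.2 + 3 * v.2 + 3 <= 2 * size (exponents L))%N.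
Proof.
move=> [uL posL L0 plane] vL.
pose P := ev C2 ('X ^+ 3) (3%:R * ('X * 'X%:P)) ('X%:P ^+ 3) L.
(* The exponents of u and v in the image of a monomial; several monomials may share them, hence the
   [undup] in [s]. *)
pose fold3 (w : expo) : nat * nat := (3 * w.1.1 + w.1.2, w.1.2 + 3 * w.2)%N.
have coefP a b : P`_a`_b = \sum_(t <- L) (t.2 * 3 ^+ t.1.1.2) * (fold3 t.1 == (a, b))%:R.
  rewrite /P /ev !coef_sum; apply: eq_bigr => -[[[a' b'] c'] r] _ /=.
  rewrite xpair_eqE -coef_monomial2; congr (fun p : {poly {poly R}} => p`_a`_b).
  rewrite -[('X ^+ 3) ^+ a']exprM -[('X%:P ^+ 3) ^+ c']exprM (exprMn _ 3%:R) (exprMn _ 'X).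
  rewrite [(b' + _)%N]addnC !exprD !rmorphM !rmorphXn /= !rmorph_nat; ring.
have fold0 : fold3 (0, 0, 0)%N = (0, 0)%N by [].
pose s := undup [seq fold3 w | w <- exponents L].
have P_ge0 a b : 0 <= P`_a`_b.
  rewrite coefP big_seq; apply: sumr_ge0 => t /(allP posL) t0.
  by rewrite !mulr_ge0 ?ler0n ?exprn_ge0 ?ler0n // ltW.
have P_supp a b : P`_a`_b != 0 -> (a, b) \in s.
  rewrite coefP mem_undup big_seq => nz; apply: contraNT nz => nL.
  rewrite big1 // => t tL; case: eqP => [e|]; rewrite ?mulr0 //.
  by case/negP: nL; rewrite -e; apply/map_f/map_f.
have [|||||bound [a xa] [b yb]] := @poly_plane_count R P s => //.
- rewrite coefP big_seq big1 // => t tL; case: eqP => [e|]; rewrite ?mulr0 //.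
  case/negP: L0; have -> : (0, 0, 0)%N = t.1; last exact: map_f.
  by case: (t.1) e => -[a b] c []; rewrite /fold3 /= => *; congr (_, _, _); lia.
- rewrite -[LHS]/(horner_eval _ _) rmorph_ev !(rmorphM, rmorphXn, rmorph_nat) /=.
  rewrite /horner_eval hornerX hornerC (@eq_ev _ _ _ polyC) => [|r /=]; last by rewrite hornerE.
  by apply: ev_plane => //; ring.
- exact: undup_uniq.
have /bound : P`_(fold3 v).1`_(fold3 v).2 != 0.
  rewrite coefP; have [t tL ->] := mapP vL.
  rewrite (big_rem t) //= gt_eqF // ltr_wpDr //.
    rewrite big_seq; apply: sumr_ge0 => u /mem_rem/(allP posL) u0.
    by rewrite !mulr_ge0 ?ler0n ?exprn_ge0 ?ler0n // ltW //.
  by rewrite eqxx mulr1 mulr_gt0 ?exprn_gt0 ?ltr0n // (allP posL).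
have := sum_off_axes (undup_uniq _) (P_supp _ _ xa) (P_supp _ _ yb).
have : (size s <= size (exponents L))%N by rewrite (leq_trans (size_undup _)) // size_map.
by rewrite /fold3 /= -/s; lia.
Qed.

Lemma small_face_expo (v : expo) : v.2 = 0%N -> v != origin -> (deg_expo v < 7)%N ->
  (7 %| weight v)%N -> v \in face_vars.
Proof.
case: v => -[a b] c /= -> v0 d7 w7.
have check : all (fun p => (p != (0, 0)%N) ==> (7 %| weight (p, 0%N))%N ==> ((p, 0%N) \in
  face_vars))
  [seq (a, b) | a <- iota 0 7, b <- iota 0 (7 - a)] by [].
have : (a, b) \in [seq (a, b) | a <- iota 0 7, b <- iota 0 (7 - a)].
  rewrite /deg_expo /= in d7; apply/allpairsPdep; exists a, b; split=> //; rewrite mem_iota; lia.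
move/(allP check); rewrite w7 /= => /implyP; apply.
by apply: contra v0 => /eqP [-> ->].
Qed.

(** Each inequality bounds one exponent by 10 through its first term, which makes the check
    finite. *)
Lemma bounded_expo (v : expo) : (7 %| weight v)%N ->
  (3 * v.1.1 + 2 * v.1.2 + 3 * v.2 <= 32)%N -> (3 * v.1.2 + 2 * v.2 + 3 * v.1.1 <= 32)%N ->
  (3 * v.2 + 2 * v.1.1 + 3 * v.1.2 <= 32)%N -> v \in origin :: main_vars.
Proof.
case: v => -[a b] c /= w7 h1 h2 h3.
have check : all (fun p => (7 %| weight p)%N ==>
   (3 * p.1.1 + 2 * p.1.2 + 3 * p.2 <= 32)%N ==> (3 * p.1.2 + 2 * p.2 + 3 * p.1.1 <= 32)%N ==>
   (3 * p.2 + 2 * p.1.1 + 3 * p.1.2 <= 32)%N ==> (p \in origin :: main_vars))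
  [seq (p, c) | p <- [seq (a, b) | a <- iota 0 11, b <- iota 0 11], c <- iota 0 11].
  by vm_compute.
have : (a, b, c) \in [seq (p, c) | p <- [seq (a, b) | a <- iota 0 11, b <- iota 0 11], c <- iota
  0 11].
  by apply: allpairs_f; [apply: allpairs_f|]; rewrite mem_iota; lia.
by move/(allP check); rewrite w7 /= h1 h2 h3.
Qed.

(** * Rigidity of the quotient for at most 28 monomials *)

Section Rigid.
Variables (R : realDomainType) (L : seq (expo * R)) (h : expo -> R).
Hypothesis unitL : plane_unit L.
Hypothesis bal : balanced (cf L) h.

Lemma cf_neq0 v : (cf L v != 0) = (v \in exponents L).
Proof.
have [uL posL _ _] := unitL; apply/idP/idP => [|/mapP[t tL ->]].
  apply: contraR => nL; rewrite /cf big_seq_cond big1 // => t /andP[tL /eqP e].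
  by case/negP: nL; rewrite -e; apply: map_f.
rewrite /cf (big_rem t) //= eqxx gt_eqF // ltr_wpDr //; last exact: (allP posL).
by rewrite big_seq_cond; apply: sumr_ge0 => u /andP[/mem_rem/(allP posL)/ltW].
Qed.

(** By [degree_bound] the form is at most 2 * 28 - 3 = 53 at the extremal monomial of G, where it
    exceeds its value at v by at least 3 * 7 = 21. *)
Lemma weight_bound v : (size (exponents L) <= 28)%N -> h v != 0 ->
  (3 * v.1.1 + 2 * v.1.2 + 3 * v.2 <= 32)%N.
Proof.
move=> N28 hv.
have [|||||w [_ gw lw]] := @extremal_term R (cf L) h predT
  (fun v => 3 * v.1.1 + 2 * v.1.2 + 3 * v.2)%N 3 2 3 bal _ _ _ _ v _ hv => //.
by have := degree_bound unitL; move=> /(_ w); rewrite -cf_neq0 gw => /(_ isT); lia.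
Qed.

(** [extremal_term] on the face gives a monomial of G of degree at least [deg_expo v + 7]; the
    strict inequality of [face_degree] adds 1. *)
Lemma face_top v : v.2 = 0%N -> h v != 0 -> (deg_expo v + 8 <= face_count (exponents L))%N.
Proof.
move=> v2 hv.
have [|||||w [/= /eqP w2 gw lw]] := @extremal_term R (cf L) h (fun v => v.2 == 0%N)
  (fun v => 1 * v.1.1 + 1 * v.1.2 + 0 * v.2)%N 1 1 0 bal _ _ _ _ v _ hv => //.
- by move=> x y; rewrite /= addn_eq0.
- by apply/eqP.
have := face_degree unitL; move=> /(_ w); rewrite -cf_neq0 gw => /(_ isT w2).
by move: lw; rewrite /deg_expo v2 /=; lia.
Qed.

Lemma all_zero_catrev vs : h origin = 1 ->
  all_zero [seq sign_of (h w) | w <- catrev vs [:: origin]] -> {in vs, forall v, h v = 0}.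
Proof.
move=> h0; rewrite catrevE => az v; rewrite -mem_rev; elim: (rev vs) az => //= w l IH.
rewrite {1}/sign_of; case: (ltgtP 0 (h w)) => [_|//|/esym hw az].
  by case: l {IH} => //= x l; case: (sign_of _).
by rewrite inE => /orP[/eqP -> //|]; apply: IH.
Qed.

Lemma cost_le (wt : expo -> nat) (ns : seq expo) : uniq ns ->
  (cost (cf L) wt ns <= \sum_(v <- exponents L) wt v)%N.
Proof.
move=> uns; have [uL _ _ _] := unitL.
rewrite /cost (bigID (fun n => cf L n != 0)) /= addnC big1 ?add0n; last first.
  by move=> n /negPn/eqP ->; rewrite eqxx muln0.
rewrite -big_filter.
apply: (@leq_trans (\sum_(n <- [seq n <- ns | cf L n != 0%R]) wt n)%N).
  by apply: leq_sum => n _; case: (_ != _); rewrite ?muln1 ?muln0.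
apply: leq_sum_subset => //; first exact: filter_uniq.
by move=> n; rewrite mem_filter cf_neq0 => /andP[].
Qed.

Lemma face_countE : face_count (exponents L) =
  (\sum_(v <- exponents L) if v.2 == 0 then face_weight v else 0)%N.
Proof. by rewrite /face_count big_mkcond. Qed.

(** The bound with 8 is [face_top]. If the weight were below 15, H would have degree at most 6 on
    the face, and [face_search] would make it constant there, although v has positive degree. *)
Lemma face_bound_count v : v.2 = 0%N -> h v != 0 ->
  (face_bound (deg_expo v) <= face_count (exponents L))%N.
Proof.
move=> v2 hv; have top := face_top v2 hv; rewrite /face_bound; case: eqP => [e|/eqP dv];
  first by rewrite e in top.
rewrite geq_max addnC [(8 + _)%N]addnC top andbT leqNgt; apply/negP => small.
have h0 := balanced_h0 bal.
have on_face w : w.2 = 0%N -> h w != 0 -> (w \in [:: origin]) || (w \in face_vars).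
  move=> w2 hw; have [->|w0] := eqVneq w origin; first by rewrite mem_head.
  rewrite small_face_expo ?orbT // ?(balanced_weight bal) //.
  by have := face_top w2 hw; move: small; lia.
suff : {in face_vars, forall v, h v = 0}.
  move=> z; have := on_face v v2 hv; rewrite inE => /orP[/eqP e|/z hz].
    by move: dv; rewrite e.
  by rewrite hz eqxx in hv.
apply: (all_zero_catrev h0).
apply: (@search_sound R (cf L) h bal face_weight (fun _ => (0, 0, 0)%N) face_vars [:: origin]
  face_nodes 14 (0, 0, 0)%N).
- by move: face_search; rewrite -[[seq _ | _ <- _]]/[:: sign_of (h origin)] h0 /sign_of ltr01.
- by [].
- move=> n; rewrite mem_filter => /andP[/eqP n2 nN]; split.
    by apply: contraTneq nN => ->.
  move=> w hw tw; apply: on_face => //; move: tw; rewrite /touches => /orP[/eqP -> //|/mapP[s _ e]].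
  by move: n2; rewrite e /= => /eqP; rewrite addn_eq0 => /andP[/eqP].
rewrite (_ : final_flags _ _ _ _ = (0, 0, 0)%N); last first.
  by rewrite /final_flags /=; case: eqP; case: eqP; case: eqP.
rewrite addn0 -ltnS (leq_trans _ small) // ltnS.
have -> : cost (cf L) face_weight face_nodes =
    cost (cf L) (fun v => if v.2 == 0%N then face_weight v else 0%N) face_nodes.
  rewrite /cost big_seq [RHS]big_seq; apply: eq_bigr => n.
  by rewrite mem_filter => /andP[-> _].
by rewrite face_countE; apply: cost_le.
Qed.

End Rigid.

Lemma eq_balanced (R : realDomainType) (g g' h : expo -> R) :
  g =1 g' -> balanced g h -> balanced g' h.
Proof. by move=> e [b1 b2 b3 b4 b5]; split=> // v; rewrite -e. Qed.

(** The inverse of [rotate] is its square, which is why it appears here twice. *)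
Lemma cf_rotate (R : nmodType) (L : seq (expo * R)) v :
  cf (rotate_terms L) v = cf L (rotate (rotate v)).
Proof.
rewrite /cf big_map; apply: eq_bigl => t /=.
by apply/eqP/eqP => [<-|->]; rewrite rotate3.
Qed.

Lemma balanced_rotate_terms (R : realDomainType) (L : seq (expo * R)) h :
  balanced (cf L) h -> balanced (cf (rotate_terms L)) (h \o rotate \o rotate).
Proof.
move=> /balanced_rotate/balanced_rotate; apply: eq_balanced => v /=.
by rewrite cf_rotate.
Qed.

(** Every monomial counts 2 in total: an interior one through [main_weight], one inside a face
    through that face, a pure power with weight 1 in each of its two faces. *)
Lemma face_count_sum K : origin \notin K ->
  (\sum_(v <- K) main_weight v + (face_count K + face_count [seq rotate v | v <- K]
     + face_count [seq rotate (rotate v) | v <- K]) = 2 * size K)%N.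
Proof.
elim: K => [|v K IH]; first by rewrite /face_count !big_nil.
rewrite inE negb_or => /andP[v0 /IH]; rewrite /face_count /= !big_cons /= mulnS => <-.
case: v v0 => -[a b] c; rewrite /rotate /main_weight /off_axes /=.
by case: a => [|a]; case: b => [|b]; case: c => [|c] //= _; lia.
Qed.

Lemma final_flags_le (R : realDomainType) (h : expo -> R) (fl : expo -> flags) (m : flags) f vs :
  le_expo f m -> {in vs, forall v, h v != 0 -> le_expo (fl v) m} ->
  le_expo (final_flags h fl f vs) m.
Proof.
elim: vs f => [|v vs IH] f fm H //=; apply: IH => [|w wvs].
  case: eqP => [//|/eqP hv]; have /and3P[l1 l2 l3] := H v (mem_head _ _) hv.
  by case/and3P: fm => *; rewrite /le_expo /= !geq_max l1 l2 l3 !andbT; apply/and3P.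
by apply: H; rewrite inE wvs orbT.
Qed.

Lemma rigid (R : realDomainType) (L : seq (expo * R)) (h : expo -> R) :
  plane_unit L -> balanced (cf L) h -> (size (exponents L) <= 28)%N ->
  forall v, v != origin -> h v = 0.
Proof.
move=> u0 b0 N28.
have u1 := plane_unit_rotate u0; have b1 := balanced_rotate_terms b0.
have u2 := plane_unit_rotate u1; have b2 := balanced_rotate_terms b1.
have N28_1 : (size (exponents (rotate_terms L)) <= 28)%N by rewrite exponents_rotate size_map.
have N28_2 : (size (exponents (rotate_terms (rotate_terms L))) <= 28)%N.
  by rewrite !exponents_rotate 2!size_map.
(* The degree bound is applied to G and to its two rotations, one inequality for each. *)
have supp v : h v != 0 -> v \in origin :: main_vars.
  move=> hv; apply: bounded_expo.
  - exact: (balanced_weight b0 hv).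
  - exact: (weight_bound u0 b0).
  - by apply: (weight_bound u1 b1 (v := rotate v)) => //=; rewrite rotate3.
  - by apply: (weight_bound u2 b2 (v := rotate (rotate v))) => //=; rewrite !rotate3.
have [_ _ o0 _] := u0.
pose fx := face_count (exponents (rotate_terms L)).
pose fy := face_count (exponents (rotate_terms (rotate_terms L))).
pose fz := face_count (exponents L).
have total := face_count_sum o0.
rewrite -exponents_rotate (map_comp rotate rotate) -!exponents_rotate -/fx -/fy -/fz in total.
have boundz v : v.2 = 0%N -> h v != 0 -> (face_bound (deg_expo v) <= fz)%N.
  exact: (face_bound_count u0 b0).
have boundx v : v.1.1 = 0%N -> h v != 0 -> (face_bound (deg_expo v) <= fx)%N.
  move=> v0 hv; have := face_bound_count u1 b1 (v := rotate v).
  by rewrite /= rotate3 => /(_ v0 hv); congr (face_bound _ <= _)%N; rewrite /deg_expo /=; lia.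
have boundy v : v.1.2 = 0%N -> h v != 0 -> (face_bound (deg_expo v) <= fy)%N.
  move=> v0 hv; have := face_bound_count u2 b2 (v := rotate (rotate v)).
  by rewrite /= !rotate3 => /(_ v0 hv); congr (face_bound _ <= _)%N; rewrite /deg_expo /=; lia.
have h0 := balanced_h0 b0; have ho : h origin != 0 by rewrite h0 oner_neq0.
(* The flags collected along the true branch stay below the actual weights of the faces. *)
have fl :
    le_expo (final_flags h main_flags (8, 8, 8)%N main_vars) (fx, fy, fz).
  apply: final_flags_le => [|v _ hv].
    by apply/and3P; split; [apply: (boundx origin)|apply: (boundy origin)|apply: (boundz origin)].
  rewrite /main_flags /=; apply/and3P; split; rewrite /=; case: eqP => // e.
  - exact: boundx.
  - exact: boundy.
  - exact: boundz.
suff z : {in main_vars, forall v, h v = 0}.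
  move=> v v0; apply/eqP; apply: contraT => hv; have := supp v hv.
  by rewrite inE (negPf v0) /= => /z hz; rewrite hz eqxx in hv.
apply: (all_zero_catrev h0).
apply: (@search_sound R (cf L) h b0 main_weight main_flags main_vars [:: origin] (nodes_of
  main_vars) 32 (8, 8, 8)%N).
- have -> : [seq sign_of (h w) | w <- [:: origin]] = [:: Plus] by rewrite /= h0 /sign_of ltr01.
  exact: main_search.
- by vm_compute.
- move=> n nN; split; first by apply: contraTneq nN => ->; vm_compute.
  by move=> w hw _; have := supp w hw; rewrite !inE.
have un : uniq (nodes_of main_vars) by exact: undup_uniq.
(* Interior and face weights add up to 2N <= 56 = 32 + 24, where 24 is the sum of the initial
   flags. *)
have := cost_le u0 main_weight un.
move: fl total N28; move: (final_flags _ _ _ _) => fl /and3P[flx fly flz].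
move: (cost _ _ _) (\sum_(v <- _) _)%N flx fly flz => c s; rewrite /sum_flags /=.
by rewrite /exponents !size_map; lia.
Qed.

(** * From rigidity to the gap *)

Lemma add_sub_expo u v : le_expo u v -> add_expo u (sub_expo v u) = v.
Proof. by case: u v => [[a b] c] [[a' b'] c'] /and3P[/= *]; rewrite /add_expo /= !subnKC. Qed.

Lemma exponents_terms (R : nzRingType) (G : {mpoly R[3]}) :
  exponents (terms G) = [seq unmon m | m <- msupp G].
Proof. by rewrite /exponents /terms -map_comp. Qed.

Lemma mem_exponents_terms (R : nzRingType) (G : {mpoly R[3]}) v :
  (v \in exponents (terms G)) = (G@_(mon v) != 0).
Proof.
rewrite -mcoeff_msupp exponents_terms; apply/mapP/idP => [[m mG ->]|mG]; first by rewrite unmonK.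
by exists (mon v); rewrite ?monK.
Qed.

Lemma uniq_exponents_terms (R : nzRingType) (G : {mpoly R[3]}) : uniq (exponents (terms G)).
Proof. by rewrite exponents_terms (map_inj_uniq (can_inj unmonK)) msupp_uniq. Qed.

Lemma special_plane_unit (R : rcfType) (eta : R[i]) (G : {mpoly R[3]}) :
  special eta G -> plane_unit (terms G).
Proof.
move=> [_ plane ge0 at0]; split.
- exact: uniq_exponents_terms.
- by apply/allP => t /mapP[m mG ->] /=; rewrite lt_def ge0 -mcoeff_msupp mG.
- by rewrite mem_exponents_terms negbK -meval_origin at0.
- by move=> x y z /plane; rewrite /meval mmap_terms.
Qed.

(** By [rigid] H = 1, so G has the same monomials as Phi. *)
Lemma special_small (R : rcfType) (eta : R[i]) (G : {mpoly R[3]}) :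
  7.-primitive_root eta -> special eta G -> (Nmon G <= 28)%N -> Nmon G = 17%N.
Proof.
move=> heta sG N28; have uG := special_plane_unit sG.
have [h bh] := special_balanced heta sG.
have bL : balanced (cf (terms G)) h by apply: eq_balanced bh => v; rewrite cf_terms.
have sz : size (exponents (terms G)) = Nmon G by rewrite exponents_terms size_map.
have h0 := rigid uG bL (eq_ind_r (fun n => n <= 28)%N N28 sz).
have hE v : h v = (v == origin)%:R.
  by case: eqP => [->|/eqP/h0 //]; rewrite (balanced_h0 bh).
rewrite -sz -[17%N]/(size Phi_expos); apply: perm_size; apply: uniq_perm => //.
  exact: uniq_exponents_terms.
move=> v; rewrite mem_exponents_terms (balanced_eq bh) hE addrAC subrr add0r psumr_neq0; last first.
  by move=> t _; rewrite /shifted; case: ifP; rewrite ?hE ?mulr0 // => _; rewrite mulr_ge0 ?ler0n.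
apply/hasP/mapP => [[t tP /=]|[t tP ->]].
  rewrite /shifted; case: ifP => [le_tv|]; last by rewrite mulr0 ltxx.
  rewrite hE; case: eqP => [e _|]; last by rewrite mulr0 ltxx.
  by exists t => //; rewrite -(add_sub_expo le_tv) e /add_expo /= !addn0; case: (t.1) => -[].
exists t => //=; rewrite /shifted /le_expo !leqnn hE /sub_expo !subnn mulr1 ltr0n.
by move: t tP; apply/allP.
Qed.

(** * Existence *)

(* In a move, [true] replaces the whole term, [false] half of it. *)
Definition step (K : seq expo) (m : expo * bool) : seq expo :=
  undup ((if m.2 then rem m.1 K else K) ++ [seq add_expo m.1 s | s <- Phi_expos]).

Fixpoint valid_moves (K : seq expo) (ms : seq (expo * bool)) : bool :=
  if ms is m :: ms' then (m.1 \in K) && valid_moves (step K m) ms' else true.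

(** K is the exact support of G. The value at the origin is left free, so that the moves can start
    from the constant 1. *)
Record realizes (R : numDomainType) (G : {mpoly R[3]}) (K : seq expo) : Prop := Realizes {
  realizes_uniq : uniq K;
  realizes_supp : forall v, (G@_(mon v) != 0) = (v \in K);
  realizes_ge0 : forall v, 0 <= G@_(mon v);
  realizes_plane : forall x y z, x + y + z = 1 -> G.@[vec3 0 x y z] = 1;
  realizes_weight : all (fun v => 7 %| weight v)%N K }.

Lemma mon_inj : injective mon.
Proof. exact: can_inj monK. Qed.

Lemma meval_mon (R : comNzRingType) (x y z : R) v :
  ('X_[mon v] : {mpoly R[3]}).@[vec3 0 x y z] = x ^+ v.1.1 * y ^+ v.1.2 * z ^+ v.2.
Proof. by rewrite /meval mmapX mmap1_vec3 monK. Qed.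

Lemma realizes_one (R : numDomainType) : realizes (1 : {mpoly R[3]}) [:: origin].
Proof.
have e v : (1 : {mpoly R[3]})@_(mon v) = (v == origin)%:R.
  by rewrite -mpolyX0 mcoeffX -(inj_eq mon_inj) eq_sym; congr ((_ == _)%:R);
    apply/mnmP => -[[|[|[|]]] ?];
    rewrite ?mnmE ?multinomE ?(tnth_nth 0%N).
split=> // [v|v|x y z _].
- by rewrite e inE pnatr_eq0 eqb0 negbK.
- by move: (e v) => ->; rewrite ler0n.
- by rewrite meval1.
Qed.

(** Adding c m (Phi - 1) changes no value on the plane, because Phi = 1 there. What is left of G and
    the added c m Phi have non-negative coefficients, so their supports unite without
    cancellation. *)
Lemma realizes_step (R : numFieldType) (G : {mpoly R[3]}) K m :
  m.1 \in K -> realizes G K -> exists G' : {mpoly R[3]}, realizes G' (step K m).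
Proof.
case: m => v full /= vK [uK supp ge0 plane wK].
have Gv0 : 0 < G@_(mon v) by rewrite lt_def supp vK ge0.
pose c := if full then G@_(mon v) else G@_(mon v) / 2%:R.
have c0 : 0 < c by rewrite /c; case: (full) => //; rewrite divr_gt0 ?ltr0n.
pose D : {mpoly R[3]} := \sum_(t <- Phi_terms) (c * t.2%:R) *: 'X_[mon (add_expo v t.1)].
exists (G + D - c *: 'X_[mon v]).
have Dge0 w : 0 <= D@_(mon w).
  rewrite raddf_sum; apply: sumr_ge0 => t _; rewrite /= mcoeffZ mcoeffX.
  by rewrite !mulr_ge0 ?ler0n // ltW.
have Dsupp w : (D@_(mon w) != 0) = (w \in [seq add_expo v s | s <- Phi_expos]).
  rewrite raddf_sum psumr_neq0 => [|t _]; last first.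
    by rewrite /= mcoeffZ mcoeffX !mulr_ge0 ?ler0n // ltW.
  apply/hasP/mapP => [[t tP /=]|[s /mapP[t tP ->] ->]].
    rewrite mcoeffZ mcoeffX (inj_eq mon_inj); case: eqP => [<- _|]; last by rewrite mulr0 ltxx.
    by exists t.1 => //; apply: map_f.
  exists t => //=; rewrite mcoeffZ mcoeffX eqxx mulr1 mulr_gt0 // ltr0n.
  by move: t tP; apply/allP.
have coefE w : (G + D - c *: 'X_[mon v])@_(mon w) = G@_(mon w) - c * (v == w)%:R + D@_(mon w).
  by rewrite mcoeffB mcoeffD mcoeffZ mcoeffX (inj_eq mon_inj) addrAC.
have rest_ge0 w : 0 <= G@_(mon w) - c * (v == w)%:R.
  case: eqP => [<-|_]; last by rewrite mulr0 subr0.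
  rewrite mulr1 subr_ge0 /c; case: (full) => //.
  by rewrite ler_pdivrMr ?ltr0n // ler_peMr // ler1n.
have rest_supp w : (G@_(mon w) - c * (v == w)%:R != 0) = (w \in if full then rem v K else K).
  have [<-|ne] := eqVneq v w; last first.
    rewrite mulr0 subr0 supp; case: (full) => //.
    by rewrite mem_rem_uniq // inE eq_sym ne.
  rewrite mulr1 /c; case: (full); first by rewrite subrr eqxx mem_rem_uniq // inE eqxx.
  rewrite vK; have -> : G@_(mon v) - G@_(mon v) / 2%:R = G@_(mon v) / 2%:R by field.
  by rewrite mulf_neq0 ?gt_eqF // invr_gt0 ltr0n.
split.
- exact: undup_uniq.
- move=> w; rewrite coefE paddr_eq0 // negb_and rest_supp Dsupp mem_undup mem_cat //.
- by move=> w; rewrite coefE addr_ge0.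
- move=> x y z s1; rewrite mevalB mevalD plane // mevalZ meval_mon.
  have -> : D.@[vec3 0 x y z] = c * (x ^+ v.1.1 * y ^+ v.1.2 * z ^+ v.2).
    rewrite -[RHS]mulr1 -(ev_Phi_plane s1) raddf_sum mulr_sumr; apply: eq_bigr => t _.
    by rewrite /= mevalZ meval_mon !exprD; ring.
  by rewrite addrK.
- apply/allP => w; rewrite mem_undup mem_cat => /orP[|/mapP[s sP ->]].
    by move=> wr; apply: (allP wK); case: (full) wr => // /mem_rem.
  have ws : (7 %| weight s)%N by move: s sP; apply/allP.
  by have := allP wK v vK; move: ws; rewrite /weight /=; lia.
Qed.

Lemma realizes_moves (R : numFieldType) (G : {mpoly R[3]}) K ms :
  valid_moves K ms -> realizes G K -> exists G' : {mpoly R[3]}, realizes G' (foldl step K ms).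
Proof.
elim: ms G K => [|m ms IH] G K /=; first by exists G.
by case/andP => mK vms /(realizes_step mK)[G']; apply: IH.
Qed.

Lemma realizes_special (R : rcfType) (eta : R[i]) (G : {mpoly R[3]}) K :
  7.-primitive_root eta -> realizes G K -> origin \notin K ->
  special eta G /\ Nmon G = size K.
Proof.
move=> heta [uK supp ge0 plane wK] K0; split.
  split=> // [x y z|m|].
  - rewrite /cevalR !mmap_terms ev_twist // ?(prim_expr_order heta) //.
    apply/allP => t /mapP[m mG ->] /=; apply: (allP wK).
    by rewrite -supp unmonK -mcoeff_msupp.
  - by rewrite -[m]unmonK.
  - by apply/eqP; rewrite meval_origin -[_ == 0]negbK supp.
transitivity (size [seq unmon m | m <- msupp G]); first by rewrite size_map.
apply: perm_size; apply: uniq_perm => //.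
  by rewrite (map_inj_uniq (can_inj unmonK)) msupp_uniq.
move=> v; rewrite -supp -mcoeff_msupp; apply/mapP/idP => [[m mG ->]|mG]; first by rewrite unmonK.
by exists (mon v); rewrite ?monK.
Qed.

Definition topped (d : nat) (K : seq expo) : bool :=
  ((d, 0, 0)%N \in K) && all (fun v => (v == (d, 0, 0)%N) || (v.1.1 < d)%N) K.

Lemma add_expo_inj u : injective (add_expo u).
Proof.
move=> [[a b] c] [[a' b'] c'] [/eqP + /eqP + /eqP]; rewrite !eqn_add2l.
by move=> /eqP -> /eqP -> /eqP ->.
Qed.

(** The 17 new monomials have x-degree at least d and the old ones other than x^d less than d, so 17
    monomials appear and one goes. The new top is x^(d + 7). *)
Lemma topped_step d K : uniq K -> origin \notin K -> topped d K ->
  let K' := step K ((d, 0, 0)%N, true) in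
  [/\ origin \notin K', topped (d + 7) K' & size K' = (size K + 16)%N].
Proof.
move=> uK K0 /andP[dK /allP topK]; set v : expo := (d, 0, 0)%N in dK topK *.
have lt_rem w : w \in rem v K -> (w.1.1 < d)%N.
  by rewrite mem_rem_uniq // inE => /andP[/negPf wv /topK]; rewrite wv.
have Phi_top s : s \in Phi_expos -> (s == (7, 0, 0)%N) || (s.1.1 < 7)%N.
  by move: s; apply/allP.
have d0 : (0 < d)%N by case: (d) @v dK K0 {topK lt_rem} => // v -> .
rewrite /step [(_, true).1]/= [(_, true).2]/=; split.
- rewrite mem_undup mem_cat negb_or; apply/andP; split.
    by apply: contra K0; exact: mem_rem.
  by apply/mapP => -[s _ []]; lia.
- rewrite /topped mem_undup mem_cat; apply/andP; split.
    by apply/orP; right; apply/mapP; exists (7, 0, 0)%N; rewrite ?inE // /add_expo /=.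
  apply/allP => w; rewrite mem_undup mem_cat => /orP[/lt_rem|/mapP[s /Phi_top sP ->]].
    by move=> wd; apply/orP; right; lia.
  case/orP: sP => [/eqP ->|s7]; first by rewrite eqxx.
  by apply/orP; right; rewrite /= ltn_add2l.
- rewrite undup_id; first by rewrite size_cat size_map size_rem //; case: (K) dK => //= *; lia.
  rewrite cat_uniq rem_uniq // map_inj_uniq; last exact: add_expo_inj.
  rewrite andTb [uniq Phi_expos]isT andbT; apply/hasP => -[w /mapP[s _ ->] /lt_rem];
    rewrite /= ltnNge leq_addr //.
Qed.

(* Found by computer search; the moves start from Phi, which [moves_ok] obtains from 1. *)
Definition small_moves : seq (nat * seq (expo * bool)) :=
  [:: (29, [:: ((1,1,1), true)]); (30, [:: ((1,1,1), false)]);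
      (32, [:: ((0,1,3), true)]); (33, [:: ((0,1,3), false)]); (34, [:: ((0,3,2), false)]);
      (37, [:: ((1,1,1), true); ((0,1,3), true)]); (38, [:: ((3,0,1), false); ((1,1,1), true)]);
      (39, [:: ((3,0,1), false); ((1,1,1), false)]); (40, [:: ((3,0,1), true); ((3,2,0), true)])]%N.

Definition large_moves : seq (nat * seq (expo * bool)) :=
  [:: (41, [:: ((5,1,0), true); ((7,0,0), true)]); (42, [:: ((5,1,0), true); ((7,0,0), false)]);
      (43, [:: ((5,1,0), false); ((7,0,0), false)]); (44, [:: ((1,1,1), true); ((7,0,0), true)]);
      (45, [:: ((1,1,1), true); ((7,0,0), false)]); (46, [:: ((1,1,1), false); ((7,0,0), false)]);
      (47, [:: ((0,1,3), true); ((7,0,0), true)]); (48, [:: ((0,1,3), true); ((7,0,0), false)]);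
      (49, [:: ((0,1,3), false); ((7,0,0), false)]); (50, [:: ((0,3,2), false); ((7,0,0), false)]);
      (51, [:: ((1,1,1), true); ((0,1,3), true); ((7,0,0), true)]);
      (52, [:: ((1,1,1), true); ((0,1,3), true); ((7,0,0), false)]);
      (53, [:: ((5,1,0), false); ((7,0,0), false); ((6,2,1), true)]);
      (54, [:: ((7,0,0), false); ((4,1,2), false); ((2,2,2), true)]);
      (55, [:: ((4,1,2), false); ((3,0,1), true); ((7,0,0), false)]);
      (56, [:: ((7,0,0), true); ((4,1,2), true); ((1,2,4), false)])]%N.

Definition moves_ok (P : pred (seq expo)) (km : nat * seq (expo * bool)) : bool :=
  let ms := (origin, true) :: km.2 in
  let K := foldl step [:: origin] ms in
  [&& valid_moves [:: origin] ms, size K == km.1, origin \notin K & P K].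

Lemma small_moves_ok : all (moves_ok xpredT) small_moves.
Proof. by vm_compute. Qed.

Lemma large_moves_ok : all (moves_ok (fun K => has (fun v => topped v.1.1 K) K)) large_moves.
Proof. by vm_compute. Qed.

Lemma exists_moves (R : numFieldType) P L k : all (moves_ok P) L -> k \in [seq km.1 | km <- L] ->
  exists (G : {mpoly R[3]}) K, [/\ realizes G K, origin \notin K, P K & size K = k].
Proof.
move=> /allP ok /mapP[km /ok /and4P[vm /eqP sz K0 PK] ->].
have [G rG] := realizes_moves vm (realizes_one R).
by exists G, (foldl step [:: origin] ((origin, true) :: km.2)).
Qed.

Lemma exists_topped (R : numFieldType) k : (41 <= k)%N ->
  exists (G : {mpoly R[3]}) K d, [/\ realizes G K, origin \notin K, topped d K & size K = k].
Proof.
(* [large_moves] covers the 16 consecutive values 41 to 56; beyond them, a move at the top monomial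
   goes from k - 16 to k. *)
elim/ltn_ind: k => k IH k41; have [k57|k57] := ltnP k 57.
  have [|G [K [rG K0 /hasP[v _ topv] sz]]] := exists_moves R (k := k) large_moves_ok.
    rewrite -[[seq _ | _ <- _]]/(iota 41 16) mem_iota k41 //.
  by exists G, K, v.1.1.
have [||G [K [d [rG K0 topd sz]]]] := IH (k - 16)%N; [lia | lia |].
have dK : (d, 0, 0)%N \in K by case/andP: topd.
have [G' rG'] := realizes_step (m := ((d, 0, 0)%N, true)) dK rG.
have [K0' top' sz'] := topped_step (realizes_uniq rG) K0 topd.
by exists G', (step K ((d, 0, 0)%N, true)), (d + 7)%N; split=> //; rewrite sz' sz; lia.
Qed.

Lemma exists_special (R : rcfType) (eta : R[i]) k : 7.-primitive_root eta ->
  k \in [:: 29; 30; 32; 33; 34]%N \/ (37 <= k)%N ->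
  exists G : {mpoly R[3]}, special eta G /\ Nmon G = k.
Proof.
move=> heta hk; suff [G [K [rG K0 sz]]] :
    exists (G : {mpoly R[3]}) K, [/\ realizes G K, origin \notin K & size K = k].
  by exists G; rewrite -sz; apply: realizes_special rG K0.
have [k41|k41] := ltnP k 41; last first.
  by have [G [K [d [rG K0 _ sz]]]] := exists_topped R k41; exists G, K.
have [|G [K [rG K0 _ sz]]] := exists_moves R (k := k) small_moves_ok; last by exists G, K.
case: hk => [|k37]; first by rewrite !inE => /or4P[|||/orP[]] /eqP ->.
have : k \in iota 37 4 by rewrite mem_iota k37.
by rewrite !inE => /or4P[] /eqP ->.
Qed.

Theorem theorem5p1 (R : realType) (eta : R[i])
  (heta : 7.-primitive_root eta) :
  (forall G : {mpoly R[3]}, special eta G -> ~ (Nmon G < 17)%N) /\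
  (forall G : {mpoly R[3]}, special eta G -> ~ (17 < Nmon G < 29)%N) /\
  (forall k : nat, k \in [:: 29; 30; 32; 33; 34]%N \/ (37 <= k)%N ->
     exists G : {mpoly R[3]}, special eta G /\ Nmon G = k).
Proof.
split=> [G sG N17|].
  have N28 : (Nmon G <= 28)%N by apply: leq_trans (ltnW N17) _.
  by rewrite (special_small heta sG N28) in N17.
split=> [G sG /andP[N17 N29]|k]; last exact: exists_special.
by rewrite (special_small heta sG N29) in N17.
Qed.
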